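(* The following is in the $\Omega$-cluster: a functional deciding, for $f:[0,1]\to\mathbb R$ of bounded variation and any $[a,b]\subset[0,1]$, whether $f$ is continuous on $[a,b]$.
   Context: $f:[0,1]\to\mathbb R$ has bounded variation if there is $k_0\in\mathbb N$ with $\sum_i|f(x_i)-f(x_{i+1})|\le k_0$ for every partition of $[0,1]$. $\Omega$-cluster: $\Omega(X)$ is defined for $X\subset[0,1]$ with $|X|\le 1$ and outputs a finite sequence that includes all elements of $X$. The $\Omega$-cluster is the class of partial functionals $\Phi$ computationally equivalent to $\Omega$ modulo $\exists^2$, i.e. $\Phi$ is computable in $\Omega$ and $\exists^2$, and $\Omega$ is computable in $\Phi$ and $\exists^2$. A description of a functional that does not determine it uniquely defines a class of functionals; such a class is in the $\Omega$-cluster if $\Omega$ is computable, modulo $\exists^2$, in all elements of the class and at least one element of the class is in the $\Omega$-cluster. Here $\exists^2:\mathbb N^{\mathbb N}\to\{0,1\}$ satisfies $\exists^2(f)=0$ iff $f(n)=0$ for some $n$. Representations: reals are fast-converging Cauchy sequences of rationals ($|q_n-q_{n+i}|<2^{-n}$); functions on the reals are functionals respecting equality of reals; sets are given by characteristic functions. Computability: Kleene's S1–S9, where partial functionals of type rank $\le 3$ (taking only total arguments, possibly undefined) are allowed as oracles. That is, $\{e\}(\vec\phi)\simeq a$ is the least relation closed under Kleene's schemes: successor, constants, projection to a number argument, composition, primitive recursion, permutation of arguments, application of an argument, and S9: $\{e\}(m,\vec\phi,\vec\psi)\simeq\{m\}(\vec\phi)$. An application of $\phi_i$ to functionals $\lambda\vec\xi.\{d\}(\vec\xi,\vec\phi)$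 has a value iff these functionals are total and $\phi_i$ is defined on them. A partial functional $\psi$ is computable in $\vec\phi$ if for some $e$, $\{e\}(\vec\xi,\vec\phi)\simeq\psi(\vec\xi)$ for all total $\vec\xi$ for which $\psi(\vec\xi)$ is defined. Functionals with outputs coded in $\mathbb N^{\mathbb N}$ are viewed as $\mathbb N$-valued with an extra number argument. *)

(* Defs.v *)
From mathcomp Require Import all_boot all_order all_algebra.
From mathcomp Require Import all_classical all_reals all_analysis.
Set Implicit Arguments.
Unset Strict Implicit.
Unset Printing Implicit Defensive.
Import Order.TTheory GRing.Theory Num.Theory numFieldNormedType.Exports.

(** * Finite types, total and partial functionals *)

Inductive ftype : Type := Nat | Arr of ftype & ftype.
Notation "s ~> t" := (Arr s t) (at level 99, right associativity).

Fixpoint total_functional (s : ftype) : Type :=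
  if s is r ~> t then total_functional r -> total_functional t else nat.

(* Every type is r1 ~> ... ~> rk ~> Nat; [targs] is the type of the k-tuples
   of total arguments of types r1, ..., rk. *)
Fixpoint targs (s : ftype) : Type :=
  if s is r ~> t then (total_functional r * targs t)%type else unit.

Fixpoint tapp (s : ftype) : total_functional s -> targs s -> nat :=
  match s with
  | Nat => fun x _ => x
  | r ~> t => fun F xi => tapp (F xi.1) xi.2
  end.

(* A partial functional takes total arguments only; [None] is "undefined". *)
Definition partial_functional (s : ftype) : Type := targs s -> option nat.

Inductive arg : Type := Num of nat | Fun s of partial_functional s.

Definition arg_of (s : ftype) : total_functional s -> arg :=
  match s with
  | Nat => fun x => Num x
  | r ~> t => fun F => Fun (fun xi => Some (tapp (s := r ~> t) F xi))
  end.

Definition some_total : Type := {s : ftype & total_functional s}.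

Fixpoint targ_seq (s : ftype) : targs s -> seq some_total :=
  match s with
  | Nat => fun=> [::]
  | r ~> t => fun xi => existT total_functional r xi.1 :: targ_seq xi.2
  end.

Definition env_of (s : ftype) (xi : targs s) : seq arg :=
  [seq arg_of (projT2 g) | g <- targ_seq xi].

(** * Kleene's schemes S1-S9 *)

(* Indices are natural numbers, namely codes of sequences of numbers headed by
   the number of the scheme. *)
Local Notation "<[ x ; .. ; y ]>" := (CodeSeq.code (x :: .. (y :: nil) ..))
  (at level 0).
Local Notation "<[ x , .. , y & s ]>" := (CodeSeq.code (x :: .. (y :: s) ..))
  (at level 0).

(* [kleene e phi a] is {e}(phi) ~ a.  In [S8], covering both S7 and S8, the
   functional phi_i is applied to its full list of arguments: the j-th one is
   the total functional lambda xi. {d_j}(xi, phi), which is just the number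
   {d_j}(phi) (with xi the empty tuple) when its type is [Nat].  In [S9], the
   number k in the index tells where phi ends and psi begins. *)
Inductive kleene : nat -> seq arg -> nat -> Prop :=
| S1 n phi : kleene <[1]> (Num n :: phi) n.+1
| S2 q phi : kleene <[2; q]> phi q
| S3 n phi : kleene <[3]> (Num n :: phi) n
| S4 g h phi b a :
    kleene h phi b -> kleene g (Num b :: phi) a -> kleene <[4; g; h]> phi a
| S5_0 g h phi a :
    kleene g phi a -> kleene <[5; g; h]> (Num 0 :: phi) a
| S5_S g h n phi b a :
    kleene <[5; g; h]> (Num n :: phi) b ->
    kleene h (Num n :: Num b :: phi) a ->
    kleene <[5; g; h]> (Num n.+1 :: phi) a
| S6 g p phi a :
    perm_eq p (iota 0 (size phi)) ->
    kleene g [seq nth (Num 0) phi i | i <- p] a ->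
    kleene <[6, g & p]> phi a
| S8 i ds phi s (F : partial_functional s) (G : targs s) a :
    i < size phi -> nth (Num 0) phi i = Fun F ->
    size ds = size (targ_seq G) ->
    (forall j, j < size ds ->
      let Gj := nth (existT total_functional Nat 0) (targ_seq G) j in
      forall xi : targs (projT1 Gj),
        kleene (nth 0 ds j) (env_of xi ++ phi) (tapp (projT2 Gj) xi)) ->
    F G = Some a ->
    kleene <[8, i & ds]> phi a
| S9 m phi psi a :
    kleene m phi a -> kleene <[9; size phi]> (Num m :: phi ++ psi) a.

Definition computable_in (s : ftype) (Psi : partial_functional s)
    (phi : seq arg) : Prop :=
  exists e : nat, forall (xi : targs s) (a : nat),
    Psi xi = Some a -> kleene e (env_of xi ++ phi) a.

Definition exists2_fun : total_functional ((Nat ~> Nat) ~> Nat) :=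
  fun f : nat -> nat => if `[< exists n, f n = 0 >] then 0 else 1.

Definition E2 : arg := arg_of exists2_fun.

(** * Representations *)

Section Representations.
Local Open Scope classical_set_scope.
Local Open Scope ring_scope.
Context (R : realType).
Implicit Types (alpha beta gamma : nat -> nat) (a b x : R).
Implicit Types (f : R -> R) (X : set R).

(* A surjection from the natural numbers onto the rationals:
   2^a 3^b 5^d is mapped to (a - b) / (d + 1). *)
Definition ratcode (c : nat) : rat :=
  ((logn 2 c)%:R - (logn 3 c)%:R) / (logn 5 c).+1%:R.

Definition fast_cauchy (q : nat -> rat) : Prop :=
  forall n i : nat, `|q n - q (n + i)%N| < 2 ^- n.

Definition rep_real alpha (x : R) : Prop :=
  fast_cauchy (ratcode \o alpha) /\
  (ratr (ratcode (alpha n)) : R) @[n --> \oo] --> x.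

(* These two do not constrain [F] on arguments not representing an element of
   [0,1]; the conditions make [F] respect equality of reals. *)
Definition rep_fun (F : total_functional ((Nat ~> Nat) ~> Nat ~> Nat)) f :
    Prop :=
  forall (alpha : nat -> nat) (x : R),
    x \in `[0, 1] -> rep_real alpha x -> rep_real (F alpha) (f x).

Definition rep_set (F : total_functional ((Nat ~> Nat) ~> Nat)) X : Prop :=
  X `<=` `[0, 1] /\
  forall (alpha : nat -> nat) (x : R), x \in `[0, 1] -> rep_real alpha x ->
    F alpha = nat_of_bool `[< X x >].

(* gamma codes the length k of the sequence, followed by the k interleaved
   representations of its elements. *)
Definition rep_seq gamma (s : seq R) : Prop :=
  gamma 0%N = size s /\
  forall i, (i < size s)%N ->
    rep_real (fun n => gamma (n * size s + i)%N.+1) (nth 0 s i).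

(** * The Omega-cluster *)

Definition Omega_type : ftype := ((Nat ~> Nat) ~> Nat) ~> Nat ~> Nat.

Definition is_Omega (Omega : partial_functional Omega_type) : Prop :=
  forall F X, rep_set F X -> is_subset1 X ->
    exists2 gamma : nat -> nat,
      forall n, Omega (F, (n, tt)) = Some (gamma n) &
      exists2 s : seq R, rep_seq gamma s & forall x, X x -> x \in s.

(* The description [is_Omega] does not determine a unique functional: being
   computable in Omega means being computable in every functional satisfying
   it, computing Omega means computing one of them. *)
Definition computable_in_Omega s (Phi : partial_functional s) : Prop :=
  forall Omega, is_Omega Omega -> computable_in Phi [:: Fun Omega; E2].

Definition computes_Omega s (Phi : partial_functional s) : Prop :=
  exists2 Omega, is_Omega Omega & computable_in Omega [:: Fun Phi; E2].

Definition in_Omega_cluster s (Phi : partial_functional s) : Prop :=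
  computable_in_Omega Phi /\ computes_Omega Phi.

Definition class_in_Omega_cluster s (C : set (partial_functional s)) : Prop :=
  (forall Phi, C Phi -> computes_Omega Phi) /\
  (exists2 Phi, C Phi & in_Omega_cluster Phi).

(** * Deciding continuity of functions of bounded variation *)

Definition BV_cont_type : ftype :=
  ((Nat ~> Nat) ~> Nat ~> Nat) ~> (Nat ~> Nat) ~> (Nat ~> Nat) ~> Nat.

Definition decides_BV_continuity (Phi : partial_functional BV_cont_type) :
    Prop :=
  forall F f alpha a beta b,
    rep_fun F f -> bounded_variation 0 1 f ->
    rep_real alpha a -> rep_real beta b -> 0 <= a -> a <= b -> b <= 1 ->
    Phi (F, (alpha, (beta, tt))) =
      Some (nat_of_bool `[< {within `[a, b], continuous f} >]).

End Representations.

(* Main.v *)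
Require Import Defs.
From mathcomp Require Import all_boot all_order all_algebra.
From mathcomp Require Import all_classical all_reals all_analysis.
From mathcomp Require Import ring lra zify.
(* [Num] must denote the constructor of [arg]. *)
Import Defs.
Set Implicit Arguments.
Unset Strict Implicit.
Unset Printing Implicit Defensive.
Import Order.TTheory GRing.Theory Num.Theory numFieldNormedType.Exports.

(** Omega from a decider: if X has at most one element, its indicator function
    has bounded variation, and it is discontinuous on a nondegenerate interval
    exactly when the interval meets X.  Querying the decider on the dyadic
    intervals of each level therefore locates the element of X.

    A decider from Omega: f is discontinuous on [a,b] iff for some rationals
    p < q the set D of those y in [a,b] such that f(y) and the values of f at
    rationals arbitrarily near y lie on opposite sides of [p,q] is nonempty.  As
    one-sided limits exist, D has no strictly decreasing sequence, so that it is
    nonempty iff it has a least element.  Whether D meets (-oo,c) is decided by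
    recursion on the rational c along this well-founded order: the set of the
    y < c in D such that D meets no (-oo,r) with r < y has at most one element,
    its characteristic function only makes recursive calls at rationals r < y,
    and Omega lists the candidates for its element. *)

Local Open Scope classical_set_scope.

(** * A calculus of Kleene computable functions *)

Local Notation code := CodeSeq.code.
Local Arguments CodeSeq.code : simpl never.

(* The typed parameters t : T are presented to a Kleene program as the list E t
   of arguments; a single index has to serve all t. *)
Record context (T : Type) := Context {
  args_at :> T -> seq arg;
  arity : nat;
  size_args : forall t, size (args_at t) = arity }.

(** Partiality sits in the choice of [T]: promises about the inputs are packed into the parameters,
    and the index has to work for these only. *)
Definition Cmp T (E : context T) (f : T -> nat) : Prop :=
  exists e, forall t, kleene e (E t) (f t).

Program Definition pushN T (E : context T) : context (T * nat) :=
  @Context _ (fun p => Num p.2 :: E p.1) (arity E).+1 _.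
Next Obligation. by move=> *; rewrite /= size_args. Qed.

Program Definition pushF s T (E : context T) :
    context (T * total_functional s) :=
  @Context _ (fun p => arg_of p.2 :: E p.1) (arity E).+1 _.
Next Obligation. by move=> *; rewrite /= size_args. Qed.

Fixpoint ntargs (s : ftype) : nat := if s is _ ~> t then (ntargs t).+1 else 0.

Lemma size_targ_seq s (xi : targs s) : size (targ_seq xi) = ntargs s.
Proof. by elim: s xi => //= r _ t IH xi; rewrite IH. Qed.

(** The bound arguments stand in front of the old ones, as S8 requires of the functionals that it
    passes to an oracle. *)
Program Definition push_args s T (E : context T) : context (T * targs s) :=
  @Context _ (fun p => env_of p.2 ++ E p.1) (ntargs s + arity E) _.
Next Obligation.
by move=> *; rewrite size_cat /env_of size_map size_targ_seq size_args.
Qed.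

(** The list of arguments stays the same; only the knowledge about the parameter grows. This serves
    computations that terminate only under [P]. *)
Program Definition restrict T (E : context T) (P : T -> Prop) :
    context {t | P t} :=
  @Context _ (fun p => E (sval p)) (arity E) _.
Next Obligation. by move=> *; rewrite /= size_args. Qed.

(* S6 and S9 bring the selected positions to the front and drop the others. *)
Definition selects T' T (E' : context T') (E : context T) (tau : T' -> T) :=
  exists p : seq nat, [/\ uniq p, all (ltn^~ (arity E')) p, size p = arity E &
    forall t', E (tau t') = [seq nth (Num 0) (E' t') i | i <- p]].

Lemma selects_refl T (E : context T) : selects E E id.
Proof.
exists (iota 0 (arity E)); split; first exact: iota_uniq.
- by apply/allP => i; rewrite mem_iota.
- by rewrite size_iota.
- by move=> t; rewrite -(size_args E t) map_nth_iota0 // take_size.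
Qed.

Lemma selects_trans T2 T1 T (E2 : context T2) (E1 : context T1) (E : context T)
    tau1 tau2 :
  selects E2 E1 tau2 -> selects E1 E tau1 -> selects E2 E (tau1 \o tau2).
Proof.
move=> [p2 [u2 a2 s2 h2]] [p1 [u1 a1 s1 h1]].
exists [seq nth 0 p2 i | i <- p1]; split.
- rewrite map_inj_in_uniq // => i j /(allP a1) hi /(allP a1) hj /eqP.
  by rewrite nth_uniq ?s2 // => /eqP.
- rewrite all_map; apply/allP => i /(allP a1) hi /=.
  by apply: (allP a2); rewrite mem_nth // s2.
- by rewrite size_map.
- move=> t /=; rewrite h1 h2 -map_comp; apply/eq_in_map => i /(allP a1) hi /=.
  by rewrite (nth_map 0) // s2.
Qed.

Lemma selects_cons T' T (E' : context T') (E : context T) T1 (E1 : context T1)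
    tau (pi : T1 -> T') :
  arity E1 = (arity E').+1 ->
  (forall t, behead (E1 t) = E' (pi t)) -> selects E' E tau ->
  selects E1 E (tau \o pi).
Proof.
move=> a1 hE [p [u a s h]]; exists (map S p); split.
- by rewrite map_inj_uniq //; exact: succn_inj.
- by rewrite all_map a1.
- by rewrite size_map.
- move=> t /=; rewrite h -hE -map_comp; apply: eq_map => i /=.
  by rewrite nth_behead.
Qed.

Lemma selects_pushN T' T (E' : context T') (E : context T) tau :
  selects E' E tau -> selects (pushN E') E (tau \o fst).
Proof. exact: selects_cons. Qed.

Lemma selects_pushF s T' T (E' : context T') (E : context T) tau :
  selects E' E tau -> selects (pushF s E') E (tau \o fst).
Proof. exact: selects_cons. Qed.

Lemma selects_restrict T' T (E' : context T') (E : context T) P tau :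
  selects E' E tau -> selects (restrict E' P) E (tau \o sval).
Proof. by move=> [p [u a s h]]; exists p; split => // t /=. Qed.

Lemma selects_lift T' T (E' : context T') (E : context T) tau :
  selects E' E tau -> selects (pushN E') (pushN E) (fun p => (tau p.1, p.2)).
Proof.
move=> [p [u a s h]]; exists (0 :: map S p); split.
- by rewrite /= map_inj_uniq ?u ?andbT; [apply/mapP => -[]|exact: succn_inj].
- by rewrite /= all_map.
- by rewrite /= size_map s.
- by move=> t /=; rewrite h -map_comp.
Qed.

(** * Composition, substitution and primitive recursion *)

Lemma cmp_const T (E : context T) n : Cmp E (fun=> n).
Proof. by eexists => t; exact: S2. Qed.

Lemma cmp_head T (E : context T) : Cmp (pushN E) snd.
Proof. by eexists => t; exact: S3. Qed.

Lemma cmp_let T (E : context T) g h :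
  Cmp E g -> Cmp (pushN E) h -> Cmp E (fun t => h (t, g t)).
Proof.
move=> [d hd] [e he]; eexists => t; apply: S4; first exact: hd.
exact: (he (t, g t)).
Qed.

Lemma cmp_eqv T' T (E' : context T') (E : context T) tau f :
  (forall t, E' t = E (tau t)) -> Cmp E f -> Cmp E' (f \o tau).
Proof. by move=> h [e he]; exists e => t; rewrite h. Qed.

Lemma cmp_ext T (E : context T) f g : f =1 g -> Cmp E f -> Cmp E g.
Proof. by move=> h [e he]; exists e => t; rewrite -h. Qed.

Lemma kleene_select (N : nat) (p : seq nat) e : uniq p -> all (ltn^~ N) p ->
  exists e', forall phi a, size phi = N ->
    kleene e [seq nth (Num 0) phi i | i <- p] a -> kleene e' phi a.
Proof.
move=> u a.
pose r := [seq i <- iota 0 N | i \notin p].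
(* S4 and S2 put the number [e] in front, and S9 then runs it on the first [size p] arguments
   only. *)
pose g := code [:: 4; code [:: 9; size p]; code [:: 2; e]].
exists (code [:: 6, g & p ++ r]) => phi b hN he.
apply: S6.
  rewrite hN uniq_perm ?iota_uniq // => [|i].
    rewrite cat_uniq u filter_uniq ?iota_uniq // andbT /=.
    by apply/hasPn => i; rewrite mem_filter => /andP[].
  rewrite mem_cat mem_filter mem_iota add0n /=.
  by case: (boolP (i \in p)) => //= /(allP a).
rewrite map_cat; apply: (@S4 _ _ _ e); first exact: S2.
by rewrite -[X in [:: 9; X]](size_map (nth (Num 0) phi)); apply: S9.
Qed.

Lemma cmp_sub T' T (E' : context T') (E : context T) tau f :
  selects E' E tau -> Cmp E f -> Cmp E' (f \o tau).
Proof.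
move=> [p [u a s h]] [e he].
have [e' he'] := kleene_select e u a; exists e' => t.
by apply: he'; rewrite ?size_args // -h.
Qed.

Lemma cmp_weak T (E : context T) f : Cmp E f -> Cmp (pushN E) (f \o fst).
Proof. by apply: cmp_sub; apply: (selects_pushN (selects_refl E)). Qed.

Definition CmpS T (E : context T) (u : T -> nat -> nat) :=
  Cmp (pushN E) (fun p => u p.1 p.2).

Lemma cmpS_sub T' T (E' : context T') (E : context T) tau u :
  selects E' E tau -> CmpS E u -> CmpS E' (u \o tau).
Proof. by move=> /selects_lift/cmp_sub h /h. Qed.

Lemma cmpS_at T (E : context T) u g :
  CmpS E u -> Cmp E g -> Cmp E (fun t => u t (g t)).
Proof. by move=> hu hg; exact: (cmp_let hg hu). Qed.

Definition empty_context : context unit :=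
  @Context unit (fun=> [::]) 0 (fun=> erefl).

Lemma selects_empty T (E : context T) : selects E empty_context (fun=> tt).
Proof. by exists [::]; split. Qed.

Definition cmp1 (h : nat -> nat) := Cmp (pushN empty_context) (fun p => h p.2).
Definition cmp2 (h : nat -> nat -> nat) :=
  Cmp (pushN (pushN empty_context)) (fun p => h p.1.2 p.2).

Lemma cmp_app1 T (E : context T) h f : cmp1 h -> Cmp E f ->
  Cmp E (fun t => h (f t)).
Proof.
move=> hh hf; apply: (cmp_let (h := fun p => h p.2)) => //.
exact: (cmp_sub (selects_lift (selects_empty E)) hh).
Qed.

Lemma cmp_app2 T (E : context T) h f g : cmp2 h -> Cmp E f -> Cmp E g ->
  Cmp E (fun t => h (f t) (g t)).
Proof.
move=> hh hf hg; apply: (cmp_let (h := fun p => h p.2 (g p.1))) => //.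
apply: (cmp_let (h := fun p => h p.1.2 p.2) (cmp_weak hg)).
exact: (cmp_sub (selects_lift (selects_lift (selects_empty E))) hh).
Qed.

Lemma cmp_rec T (E : context T) g h f :
  (forall t, f (t, 0) = g t) ->
  (forall t n, f (t, n.+1) = h (t, f (t, n), n)) ->
  Cmp E g -> Cmp (pushN (pushN E)) h -> Cmp (pushN E) f.
Proof.
move=> f0 fS [d hd] [e he]; exists (code [:: 5; d; e]) => -[t n] /=.
elim: n => [|n IH]; first by rewrite f0; apply: S5_0.
by rewrite fS; apply: S5_S IH _; exact: (he (t, f (t, n), n)).
Qed.

Lemma cmp_var0 T (E : context T) : Cmp (pushN E) (fun p => p.2).
Proof. exact: cmp_head. Qed.
Lemma cmp_var1 T (E : context T) : Cmp (pushN (pushN E)) (fun p => p.1.2).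
Proof. exact: (cmp_weak (cmp_head E)). Qed.
Lemma cmp_var2 T (E : context T) :
  Cmp (pushN (pushN (pushN E))) (fun p => p.1.1.2).
Proof. exact: (cmp_weak (cmp_var1 E)). Qed.

(** * Primitive recursive arithmetic *)

Lemma cmp1_succ : cmp1 succn.
Proof. by eexists => t; exact: S1. Qed.

Lemma cmp2_rec h g k : (forall m, h m 0 = g m) ->
  (forall m n, h m n.+1 = k m (h m n) n) -> cmp1 g ->
  Cmp (pushN (pushN (pushN empty_context))) (fun p => k p.1.1.2 p.1.2 p.2) ->
  cmp2 h.
Proof. 
move=> h0 hS hg hk.
by apply: (@cmp_rec _ _ (fun p => g p.2)
  (fun p => k p.1.1.2 p.1.2 p.2) (fun p => h p.1.2 p.2)) => //= -[].
Qed.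

Lemma cmp1_rec h c k : h 0 = c -> (forall n, h n.+1 = k (h n) n) ->
  cmp2 k -> cmp1 h.
Proof.
by move=> h0 hS; apply: (@cmp_rec _ _ (fun=> c)) => //=; exact: cmp_const.
Qed.

Lemma cmp2_add : cmp2 addn.
Proof.
apply: (@cmp2_rec _ id (fun _ b _ => b.+1)) => [m|m n||].
- exact: addn0.
- exact: addnS.
- exact: cmp_var0.
- exact: cmp_app1 cmp1_succ (cmp_var1 _).
Qed.

Lemma cmp2_mul : cmp2 muln.
Proof.
apply: (@cmp2_rec _ (fun=> 0) (fun m b _ => b + m)) => [m|m n||].
- exact: muln0.
- by rewrite mulnS addnC.
- exact: cmp_const.
- exact: cmp_app2 cmp2_add (cmp_var1 _) (cmp_var2 _).
Qed.

Lemma cmp2_exp : cmp2 expn.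
Proof.
apply: (@cmp2_rec _ (fun=> 1) (fun m b _ => b * m)) => [m|m n||].
- exact: expn0.
- by rewrite expnS mulnC.
- exact: cmp_const.
- exact: cmp_app2 cmp2_mul (cmp_var1 _) (cmp_var2 _).
Qed.

Lemma cmp1_pred : cmp1 predn.
Proof.
by apply: (@cmp1_rec _ 0 (fun _ n => n)) => //; exact: cmp_var0.
Qed.

Lemma cmp2_sub : cmp2 subn.
Proof.
apply: (@cmp2_rec _ id (fun _ b _ => b.-1)) => [m|m n||].
- exact: subn0.
- by rewrite subnS.
- exact: cmp_var0.
- exact: cmp_app1 cmp1_pred (cmp_var1 _).
Qed.

Lemma cmp_succ T (E : context T) f : Cmp E f -> Cmp E (fun t => (f t).+1).
Proof. exact: cmp_app1 cmp1_succ. Qed.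
Lemma cmp_add T (E : context T) f g : Cmp E f -> Cmp E g ->
  Cmp E (fun t => f t + g t).
Proof. exact: cmp_app2 cmp2_add. Qed.
Lemma cmp_mul T (E : context T) f g : Cmp E f -> Cmp E g ->
  Cmp E (fun t => f t * g t).
Proof. exact: cmp_app2 cmp2_mul. Qed.
Lemma cmp_subn T (E : context T) f g : Cmp E f -> Cmp E g ->
  Cmp E (fun t => f t - g t).
Proof. exact: cmp_app2 cmp2_sub. Qed.
Lemma cmp_exp T (E : context T) f g : Cmp E f -> Cmp E g ->
  Cmp E (fun t => f t ^ g t).
Proof. exact: cmp_app2 cmp2_exp. Qed.

(** * Decidable predicates *)

Definition Dec T (E : context T) (P : T -> Prop) :=
  Cmp E (fun t => nat_of_bool `[< P t >]).

Lemma dec_ext T (E : context T) P Q : (forall t, P t <-> Q t) ->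
  Dec E P -> Dec E Q.
Proof.
by move=> h; apply: cmp_ext => t; congr nat_of_bool; apply: asbool_equiv_eq.
Qed.

Lemma dec_eq0 T (E : context T) f : Cmp E f -> Dec E (fun t => f t = 0).
Proof.
move=> hf; have h : cmp1 (fun n => 1 - n).
  exact: cmp_subn (cmp_const _ _) (cmp_var0 _).
apply: cmp_ext (cmp_app1 h hf) => t.
by case: (f t) => [|n]; case: asboolP.
Qed.

Lemma dec_leq T (E : context T) f g : Cmp E f -> Cmp E g ->
  Dec E (fun t => f t <= g t).
Proof.
move=> hf hg; apply: dec_ext (dec_eq0 (cmp_subn hf hg)) => t.
by rewrite -subn_eq0; split => /eqP.
Qed.

Lemma dec_not T (E : context T) P : Dec E P -> Dec E (fun t => ~ P t).
Proof.
move=> /dec_eq0; apply: dec_ext => t.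
by case: asboolP.
Qed.

Lemma dec_and T (E : context T) P Q : Dec E P -> Dec E Q ->
  Dec E (fun t => P t /\ Q t).
Proof.
move=> hP hQ; apply: cmp_ext (cmp_mul hP hQ) => t.
by rewrite asbool_and; do 2!case: asboolP.
Qed.

Lemma dec_eq T (E : context T) f g : Cmp E f -> Cmp E g ->
  Dec E (fun t => f t = g t).
Proof.
move=> hf hg; apply: dec_ext (dec_and (dec_leq hf hg) (dec_leq hg hf)) => t.
by split=> [[h1 h2]|->//]; apply/eqP; rewrite eqn_leq h1.
Qed.

Lemma dec_or T (E : context T) P Q : Dec E P -> Dec E Q ->
  Dec E (fun t => P t \/ Q t).
Proof.
move=> /dec_not hP /dec_not hQ; apply: dec_ext (dec_not (dec_and hP hQ)) => t.
by rewrite not_andP !notK.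
Qed.

Lemma dec_imp T (E : context T) P Q : Dec E P -> Dec E Q ->
  Dec E (fun t => P t -> Q t).
Proof.
move=> hP /dec_not hQ; apply: dec_ext (dec_not (dec_and hP hQ)) => t.
rewrite not_andP notK; split=> [[|]//|h].
by have [/h|] := pselect (P t); [right|left].
Qed.

(* S5 evaluates its base case in both branches, so the guarded computation is
   placed in the step, which is reached only when the guard holds. *)
Lemma dec_guard T (E : context T) P Q : Dec E P ->
  Dec (restrict E P) (fun s => Q (sval s)) -> Dec E (fun t => P t /\ Q t).
Proof.
move=> hP [e he].
(* In the step of S5 the counter and the previous value come first; selecting from position 2 on
   recovers [E t]. *)
have [e' he'] := @kleene_select (arity E).+2 (iota 2 (arity E)) e
  (iota_uniq _ _) ltac:(by apply/allP => i; rewrite mem_iota; case/andP).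
have [d hd] := hP.
eexists => t; apply: (S4 (hd t) (g := code [:: 5; code [:: 2; 0]; e'])).
rewrite asbool_and; case: asboolP => hPt /=; last by apply: S5_0; exact: S2.
apply: (@S5_S _ _ _ _ 0); first by apply: S5_0; exact: S2.
apply: he'; first by rewrite /= size_args.
rewrite (_ : map _ _ = E t); last first.
  rewrite -(size_args E t) (iotaDl 2 0) -map_comp.
  by rewrite -[RHS](mkseq_nth (Num 0)).
exact: (he (exist _ t hPt)).
Qed.

Lemma cmp_if T (E : context T) P f g : Dec E P -> Cmp E f -> Cmp E g ->
  Cmp E (fun t => if `[< P t >] then f t else g t).
Proof.
move=> hP hf hg.
apply: cmp_ext (cmp_add (cmp_mul hP hf) (cmp_mul (dec_not hP) hg)) => t.
by rewrite asbool_neg; case: asboolP; rewrite /= ?mul1n ?mul0n ?addn0 ?add0n.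
Qed.

(** * Application of functionals and quantification over numbers *)

Definition provides T (E : context T) s (F : T -> partial_functional s) :=
  exists i, forall t, nth (Num 0) (E t) i = Fun (F t).

Lemma provides_sub T' T (E' : context T') (E : context T) tau s F :
  selects E' E tau -> @provides T E s F -> @provides T' E' s (F \o tau).
Proof.
move=> [p [u a sp h]] [i hi]; exists (nth 0 p i) => t.
rewrite /= -hi h (nth_map 0) // ltnNge; apply/negP => le_p.
(* A position out of range would yield the default [Num 0], which is not a functional. *)
by have := hi (tau t); rewrite h nth_default ?size_map.
Qed.

Lemma provides_weak T (E : context T) s (F : T -> partial_functional s) :
  provides E F -> provides (pushN E) (F \o fst).
Proof. by apply: provides_sub; apply: (selects_pushN (selects_refl E)). Qed.

Fixpoint Cmp_args T (E : context T) s : (T -> targs s) -> Prop :=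
  match s with
  | Nat => fun=> True
  | r ~> t => fun G =>
      Cmp (push_args r E) (fun p => tapp (G p.1).1 p.2) /\
      Cmp_args E (fun t => (G t).2)
  end.

Lemma cmp_args_codes T (E : context T) s (G : T -> targs s) : Cmp_args E G ->
  exists ds, forall t, size ds = size (targ_seq (G t)) /\
    (forall j, j < size ds ->
      let Gj := nth (existT total_functional Nat 0) (targ_seq (G t)) j in
      forall xi : targs (projT1 Gj),
        kleene (nth 0 ds j) (env_of xi ++ E t) (tapp (projT2 Gj) xi)).
Proof.
elim: s G => [|r _ s IH] G /=; first by exists [::].
move=> [[d hd] /IH[ds hds]]; exists (d :: ds) => t /=.
have [-> h] := hds t; split => // -[_ xi|j]; first exact: (hd (t, xi)).
by rewrite ltnS => /h.
Qed.

Lemma cmp_app T (E : context T) s (F : T -> partial_functional s)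
    (G : T -> targs s) f : provides E F -> (forall t, F t (G t) = Some (f t)) ->
  Cmp_args E G -> Cmp E f.
Proof.
move=> [i hi] hf /cmp_args_codes[ds hds].
exists (code [:: 8, i & ds]) => t; have [h1 h2] := hds t.
apply: (S8 _ (hi t) h1 h2 (hf t)); rewrite ltnNge; apply/negP => le_i.
by have := hi t; rewrite nth_default.
Qed.

Definition tot s (F : total_functional s) : partial_functional s :=
  fun xi => Some (tapp F xi).

Lemma cmp_args_Nat T (E : context T) (f : T -> nat) :
  Cmp E f -> Cmp (push_args Nat E) (fun p => @tapp Nat (f p.1) p.2).
Proof. by apply: (cmp_eqv (tau := fst)). Qed.

Lemma cmp_args_seq T (E : context T) (u : T -> nat -> nat) :
  CmpS E u -> Cmp (push_args (Nat ~> Nat) E)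
    (fun p => @tapp (Nat ~> Nat) (u p.1) p.2).
Proof. by apply: (cmp_eqv (tau := fun p => (p.1, p.2.1))). Qed.

Lemma cmp_app_seq T (E : context T) (u : T -> nat -> nat) f :
  provides E (fun t => @tot (Nat ~> Nat) (u t)) -> Cmp E f ->
  Cmp E (fun t => u t (f t)).
Proof.
move=> hu hf.
apply: (@cmp_app _ _ (Nat ~> Nat) _ (fun t => (f t, tt)) _ hu) => //.
by split => //; exact: (@cmp_args_Nat _ E f).
Qed.

Definition E2_fun : partial_functional ((Nat ~> Nat) ~> Nat) :=
  @tot ((Nat ~> Nat) ~> Nat) exists2_fun.

Lemma dec_ex T (E : context T) (P : T -> nat -> Prop) :
  provides E (fun=> E2_fun) -> Dec (pushN E) (fun p => P p.1 p.2) ->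
  Dec E (fun t => exists n, P t n).
Proof.
move=> h2 /dec_not h.
(* [u t] vanishes exactly where [P t] holds, so E2 returns 0 exactly if there is a witness. *)
pose u t n := nat_of_bool `[< ~ P t n >].
have : Cmp E (fun t => exists2_fun (u t)).
  apply: (@cmp_app _ _ ((Nat ~> Nat) ~> Nat) _ (fun t => (u t, tt)) _ h2) => //.
  by split=> //; exact: (@cmp_args_seq _ E u).
move=> /dec_eq0; apply: dec_ext => t; rewrite /exists2_fun.
case: asboolP => [[n un]|h'] /=.
  split=> // _; exists n; move: un; rewrite /u.
  by case: asboolP => // /contrapT.
by split=> // -[n Pn]; case: h'; exists n; rewrite /u asboolF //; exact.
Qed.

Lemma dec_all T (E : context T) (P : T -> nat -> Prop) :
  provides E (fun=> E2_fun) -> Dec (pushN E) (fun p => P p.1 p.2) ->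
  Dec E (fun t => forall n, P t n).
Proof.
move=> h2 /dec_not /(dec_ex (P := fun t n => ~ P t n) h2) /dec_not.
apply: dec_ext => t.
by rewrite -forallNP; split=> h n; have := h n; rewrite notK.
Qed.

(* Self-application replaces the recursion theorem: the index of the recursion
   is carried along as an argument, so no index is ever computed from codes. *)
Section Recursion.
Variables (T : Type) (E : context T) (lt : T -> nat -> nat -> Prop).
Variable f : T -> nat -> nat.

(** The state of one recursive call. The field [call_ih] is the induction hypothesis in
    computational form: the carried index is correct at all smaller arguments, so programs over this
    type may make such calls. *)
Record call := Call {
  call_param : T; call_num : nat; call_index : nat;
  call_ih : forall c, lt call_param c call_num ->
    kleene call_index (Num call_index :: Num c :: E call_param)
      (f call_param c) }.

Program Definition call_context : context call :=
  @Context _ (fun b => Num (call_index b) :: Num (call_num b) ::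
    E (call_param b)) (arity E).+2 _.
Next Obligation. by move=> *; rewrite /= size_args. Qed.

(** The body [b] is started with its own index as first argument. Induction along [lt] supplies the
    field [call_ih] for each call. *)
Lemma cmp_fix : (forall t, well_founded (lt t)) ->
  Cmp call_context (fun b => f (call_param b) (call_num b)) -> CmpS E f.
Proof.
move=> wf [b hb].
exists (code [:: 4; b; code [:: 2; b]]) => -[t c] /=.
apply: (@S4 _ _ _ b); first exact: S2.
elim: c / (wf t c) => c _ IH.
exact: (hb (@Call t c b IH)).
Qed.

Lemma selects_call : selects call_context E call_param.
Proof.
exists (iota 2 (arity E)); split; first exact: iota_uniq.
- by apply/allP => i; rewrite mem_iota => /andP[].
- by rewrite size_iota.
- move=> b /=; rewrite -(size_args E (call_param b)) (iotaDl 2 0) -map_comp.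
  by rewrite -[LHS](mkseq_nth (Num 0)).
Qed.

Lemma cmp_call_num : Cmp call_context call_num.
Proof.
have [e he] := @kleene_select (arity E).+2 [:: 1] (code [:: 3]) isT isT.
by exists e => b; apply: he; [rewrite /= size_args | exact: S3].
Qed.

Lemma cmp_call_index : Cmp call_context call_index.
Proof. by eexists => t; exact: S3. Qed.

Lemma cmp_call T' (E' : context T') b (g : T' -> nat) :
  selects E' call_context b -> Cmp E' g ->
  (forall t, lt (call_param (b t)) (g t) (call_num (b t))) ->
  Cmp E' (fun t => f (call_param (b t)) (g t)).
Proof.
move=> hb hg hlt.
have hE := selects_trans hb selects_call.
have [p [u a s h]] := selects_lift (selects_lift hE).
have [e he] := @kleene_select (arity E').+3
  (0 :: map S p) (code [:: 9; (arity E).+2])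
  ltac:(by rewrite /= map_inj_uniq ?u ?andbT;
           [apply/mapP => -[]|exact: succn_inj])
  ltac:(by rewrite /= all_map).
have [d hd] := hg.
have [i hi] := cmp_sub hb cmp_call_index.
have [j hj] := cmp_weak (cmp_sub hb cmp_call_index).
have [k hk] := cmp_weak (cmp_weak (cmp_sub hb cmp_call_index)).
(* Pushes the new argument and then the index twice: S9 consumes one copy as the program to run, and
   the other is handed on to that program. *)
exists (code [:: 4; code [:: 4; code [:: 4; e; k]; j]; d]) => t.
apply: (S4 (hd t)); apply: (S4 (hj (t, g t))) => /=.
set q := call_index _.
apply: (S4 (hk ((t, g t), q))) => /=.
apply: he; first by rewrite /= size_args.
have /= := h ((t, g t), q) => hq.
rewrite /= -map_comp (_ : map _ p = Num q :: Num (g t) :: E (call_param (b t))).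
  pose phi := Num q :: Num (g t) :: E (call_param (b t)).
  rewrite -/phi -[phi]cats0 (_ : (arity E).+2 = size phi); last first.
    by rewrite /= size_args.
  by apply: S9; exact: call_ih (hlt t).
by rewrite hq.
Qed.

End Recursion.
Arguments call_param {T E lt f}.
Arguments call_num {T E lt f}.

(** * Rational codes and represented reals *)

Section RationalCodes.
Local Open Scope ring_scope.

Lemma ratcodeE i j d :
  ratcode (2 ^ i * (3 ^ j * 5 ^ d)) = (i%:R - j%:R) / d.+1%:R.
Proof.
have l p (h : prime p) : logn p (2 ^ i * (3 ^ j * 5 ^ d))%N =
    (i * logn p 2 + (j * logn p 3 + d * logn p 5))%N.
  by rewrite !lognM ?muln_gt0 ?expn_gt0 // !lognX.
by rewrite /ratcode !l // !logn_prime //= !muln0 !muln1 !add0n !addn0.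
Qed.

Lemma ratcode_surj q : exists c, ratcode c = q.
Proof.
have [n hn] : exists n, denq q = n.+1%:Z.
  by case: (denq q) (denq_gt0 q) => [[|n]|] // _; exists n.
have hq : q = (numq q)%:~R / n.+1%:R by rewrite -[LHS]divq_num_den hn.
case: (numq q) hq => i ->.
  by exists (2 ^ i * (3 ^ 0 * 5 ^ n))%N; rewrite ratcodeE subr0.
exists (2 ^ 0 * (3 ^ i.+1 * 5 ^ n))%N.
by rewrite ratcodeE sub0r NegzE rmorphN.
Qed.

Definition frac (j d : nat) : nat := (2 ^ j * (3 ^ 0 * 5 ^ d))%N.

(* The only relation between rationals that is programmed; comparison of reals
   is arithmetical in it, hence decided by E2. *)
Definition ltc (p q n : nat) : Prop := ratcode p < ratcode q + 2 ^- n.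

(** Multiplying out the positive denominators leaves an inequality between natural numbers, which
    can be programmed. *)
Lemma ltcE p q n : ltc p q n <->
  ((logn 2 p * (logn 5 q).+1 + logn 3 q * (logn 5 p).+1) * 2 ^ n <
   (logn 2 q * (logn 5 p).+1 + logn 3 p * (logn 5 q).+1) * 2 ^ n +
   (logn 5 p).+1 * (logn 5 q).+1)%N.
Proof.
rewrite /ltc /ratcode.
move: (logn 2 p) (logn 3 p) (logn 5 p) (logn 2 q) (logn 3 q) (logn 5 q).
move=> a b d a' b' d'.
have d0 : 0 < (d.+1%:R : rat) by rewrite ltr0n.
have d'0 : 0 < (d'.+1%:R : rat) by rewrite ltr0n.
have n0 : 0 < (2 ^+ n : rat) by rewrite exprn_gt0.
rewrite -(ltr_nat rat) !(natrD, natrM, natrX).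
have h : 0 < (d.+1%:R : rat) * d'.+1%:R * 2 ^+ n by rewrite !mulr_gt0.
rewrite -(ltr_pM2r h) -subr_gt0 -[X in _ <-> is_true X]subr_gt0.
rewrite (_ : _ - _ = (a'%:R * d.+1%:R + b%:R * d'.+1%:R) * 2 ^+ n +
   d.+1%:R * d'.+1%:R - (a%:R * d'.+1%:R + b'%:R * d.+1%:R) * 2 ^+ n) //.
by field; rewrite !lt0r_neq0.
Qed.

End RationalCodes.

(** * Order and approximation of represented reals *)

Section Reals.
Local Open Scope ring_scope.
Context (R : realType).
Implicit Types (x y : R) (u v : nat -> nat).

Definition rc c : R := ratr (ratcode c).

Lemma rc_frac j d : rc (frac j d) = j%:R / d.+1%:R.
Proof. by rewrite /rc ratcodeE subr0 rmorphM /= fmorphV !rmorph_nat. Qed.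

Lemma rc_dense x y : x < y -> exists c, x < rc c < y.
Proof.
move=> /rat_in_itvoo[q]; rewrite in_itv /= => h.
by have [c hc] := ratcode_surj q; exists c; rewrite /rc hc.
Qed.

Lemma ltcR p q n : ltc p q n <-> rc p < rc q + 2 ^- n.
Proof.
by rewrite /ltc -(ltr_rat R) rmorphD /= fmorphV rmorphXn /= rmorph_nat.
Qed.

(** The order of the limits in arithmetical form: [~ ltc] says that from [M] on [v] exceeds [u] by
    at least 2^-n. *)
Definition RLt u v := exists n M, forall m, ~ ltc (v (M + m)%N) (u (M + m)%N) n.

Lemma exists_half_power (e : R) : 0 < e -> exists n, 2 ^- n < e.
Proof.
move=> e0; have [N _ h] := near_infty_natSinv_expn_lt (PosNum e0).
by exists N; have := h N (leqnn N); rewrite /= div1r.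
Qed.

Lemma RLtP u v x y :
  rc (u n) @[n --> \oo] --> x -> rc (v n) @[n --> \oo] --> y ->
  RLt u v <-> x < y.
Proof.
move=> ux vy; split.
  move=> [n [M h]]; have n0 : 0 < (2 ^- n : R) by rewrite invr_gt0 exprn_gt0.
  apply: (@lt_le_trans _ _ (x + 2 ^- n)); first by rewrite ltrDl.
  apply: (ler_cvg_to (cvgD ux (cvg_cst (2 ^- n : R))) vy).
  near=> m; rewrite leNgt; apply/negP.
  have -> : m = (M + (m - M))%N.
    by rewrite subnKC //; near: m; exact: nbhs_infty_ge.
  by move=> /ltcR; exact: h.
rewrite -subr_gt0 => /exists_half_power[n hn]; exists n.
have [M _ h] := cvgr_gt _ (cvgB vy ux) _ hn.
exists M => m /ltcR; apply/negP; rewrite -leNgt.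
have : 2 ^- n < rc (v (M + m)%N) - rc (u (M + m)%N) := h _ (leq_addr _ _).
lra.
Unshelve. all: by end_near. Qed.

(** [fast_cauchy] in terms of the programmed comparison [ltc], so that E2 decides it. *)
Definition fast u :=
  forall n i, ltc (u n) (u (n + i)%N) n /\ ltc (u (n + i)%N) (u n) n.

Lemma fastE u : fast u <-> fast_cauchy (ratcode \o u).
Proof.
split=> h n i; have := h n i; rewrite /= /ltc ltr_norml.
  by move=> [h1 h2]; apply/andP; split; lra.
by move=> /andP[h1 h2]; split; lra.
Qed.

(** By completeness of the reals, the test [fast] recognises the sequences that represent some
    real. *)
Lemma fast_rep u : fast u -> exists x, rep_real u x.
Proof.
move=> fu; suff /cvg_ex[x hx] : cvg (rc (u n) @[n --> \oo]).
  by exists x; split => //; exact/fastE.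
apply: cauchy_cvg; apply: cauchy_exP => e e0.
have [n hn] := exists_half_power e0; exists (rc (u n)), n => // m /= nm.
have := fu n (m - n)%N; rewrite subnKC // => -[/ltcR h1 /ltcR h2].
by rewrite /ball /= ltr_norml; apply/andP; split; lra.
Qed.

Lemma half_power_cvg0 : (2 ^- n : R) @[n --> \oo] --> 0.
Proof.
rewrite (_ : (fun n => _) = geometric 1 2^-1); last first.
  by apply/funext => n; rewrite /= mul1r exprVn.
by apply: cvg_geometric; rewrite ger0_norm ?invr_ge0 // invf_lt1 // ltr1n.
Qed.

(** Two errors of at most 2^-(n+2) add up to at most 2^-(n+1), strictly less than the 2^-n allowed
    by [fast_cauchy]. *)
Lemma rep_approx u x : (forall n, `|rc (u n) - x| <= 2 ^- n.+2) -> rep_real u x.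
Proof.
move=> hu; split.
  apply/fastE => n i.
  have half k : (2 ^- k : R) = 2 ^- k.+1 + 2 ^- k.+1.
    by rewrite exprS invfM mulrC -splitr.
  have h1 := hu n; have h2 : `|rc (u (n + i)%N) - x| <= 2 ^- n.+2.
    apply: (le_trans (hu _)).
    by rewrite lef_pV2 ?posrE ?exprn_gt0 // ler_weXn2l ?ler1n // !ltnS leq_addr.
  have pos : 0 < (2 ^- n.+2 : R) by rewrite invr_gt0 exprn_gt0.
  move: h1 h2 pos; rewrite !ltcR (half n) (half n.+1).
  move: (2 ^- n.+2) => e; rewrite !ler_norml => /andP[? ?] /andP[? ?] ?.
  by split; lra.
apply/cvgrPdist_le => e e0.
have [N _ hN] := cvgr_lt _ half_power_cvg0 _ e0.
exists N => // n /= Nn; rewrite distrC (le_trans (hu n)) // ltW //.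
by apply: (hN n.+2); rewrite /= (leq_trans Nn) // -addn2 leq_addr.
Qed.

Lemma rep_exists x : exists u, rep_real u x.
Proof.
have h n : exists c, x < rc c < x + 2 ^- n.+2.
  by apply: rc_dense; rewrite ltrDl invr_gt0 exprn_gt0.
have [u hu] := choice h; exists u; apply: rep_approx => n.
have /andP[h1 h2] := hu n.
by rewrite ger0_norm ?subr_ge0 ?(ltW h1) // lerBlDl ltW.
Qed.

Lemma rep_cst c : rep_real (fun=> c) (rc c).
Proof.
split; last exact: cvg_cst.
by apply/fastE => n i; split; apply/ltcR; rewrite ltrDl invr_gt0 exprn_gt0.
Qed.

Lemma rep_unique u x y : rep_real u x -> rep_real u y -> x = y.
Proof. by move=> [_ hx] [_ hy]; exact: (cvg_unique _ hx hy). Qed.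

Lemma RLt_rep u v x y : rep_real u x -> rep_real v y -> RLt u v <-> x < y.
Proof. by move=> [_ ux] [_ vy]; exact: RLtP. Qed.

End Reals.

(** * Jumps of functions of bounded variation *)

Section Jumps.
Local Open Scope ring_scope.
Context (R : realType).
Implicit Types (x y : R) (f g : R -> R).
Local Notation rc := (@rc R).

Lemma at_rightE x (P : set R) : (\forall z \near x^'+, P z) <->
  exists2 e, 0 < e & forall z, x < z < x + e -> P z.
Proof.
split.
  move=> [e /= e0 h]; exists e => // z /andP[xz zx].
  by apply: h => //=; rewrite ltr_norml; apply/andP; split; lra.
move=> [e e0 h]; exists e => // z /=; rewrite ltr_norml => /andP[h1 h2] xz.
by apply: h; apply/andP; split; lra.
Qed.

Lemma at_leftE x (P : set R) : (\forall z \near x^'-, P z) <->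
  exists2 e, 0 < e & forall z, x - e < z < x -> P z.
Proof.
split.
  move=> [e /= e0 h]; exists e => // z /andP[xz zx].
  by apply: h => //=; rewrite ltr_norml; apply/andP; split; lra.
move=> [e e0 h]; exists e => // z /=; rewrite ltr_norml => /andP[h1 h2] xz.
by apply: h; apply/andP; split; lra.
Qed.

Lemma nondecreasing_right_limit g x :
  {in `[0, 1] &, nondecreasing_fun g} -> 0 <= x < 1 -> cvg (g z @[z --> x^'+]).
Proof.
move=> ndg /andP[x0 x1].
have e0 : 0 < 1 - x by lra.
apply: nondecreasing_at_right_is_cvgr; apply/at_rightE;
  exists (1 - x) => // z /andP[z0 z1].
  move=> u v; rewrite !in_itv /= => /andP[u0 u1] /andP[v0 v1].
  by apply: ndg; rewrite in_itv /=; apply/andP; split; lra.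
exists (g x) => _ [u /= + <-]; rewrite in_itv /= => /andP[u0 u1].
by apply: ndg; rewrite ?in_itv /=; try (apply/andP; split); lra.
Qed.

Lemma nondecreasing_left_limit g x :
  {in `[0, 1] &, nondecreasing_fun g} -> 0 < x <= 1 -> cvg (g z @[z --> x^'-]).
Proof.
move=> ndg /andP[x0 x1].
apply: nondecreasing_at_left_is_cvgr; apply/at_leftE;
  exists x => // z /andP[z0 z1].
  move=> u v; rewrite !in_itv /= => /andP[u0 u1] /andP[v0 v1].
  by apply: ndg; rewrite in_itv /=; apply/andP; split; lra.
exists (g x) => _ [u /= + <-]; rewrite in_itv /= => /andP[u0 u1].
by apply: ndg; rewrite ?in_itv /=; try (apply/andP; split); lra.
Qed.

(** The Jordan decomposition. It reduces the existence of one-sided limits to monotone functions. *)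
Lemma BV_decomposition f : bounded_variation 0 1 f ->
  exists g h, [/\ {in `[0, 1] &, nondecreasing_fun g},
    {in `[0, 1] &, nondecreasing_fun h} & {in `[0, 1], f =1 g \- h}].
Proof.
move=> bv; exists (fine \o pos_tv 0 f), (fine \o neg_tv 0 f); split.
- exact/fine_neg_tv_nondecreasing/bounded_variationN.
- exact: fine_neg_tv_nondecreasing.
- exact: bounded_variation_pos_neg_tvE.
Qed.

Lemma BV_right_limit f x : bounded_variation 0 1 f -> 0 <= x < 1 ->
  exists l : R, f z @[z --> x^'+] --> l.
Proof.
move=> /BV_decomposition[g [h [ndg ndh fE]]] x01.
have /cvg_ex[l hl] := nondecreasing_right_limit ndg x01.
have /cvg_ex[k hk] := nondecreasing_right_limit ndh x01.
exists (l - k); apply: cvg_trans (cvgB hl hk).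
apply: near_eq_cvg; apply/at_rightE; move/andP: x01 => [x0 x1].
exists (1 - x); first by lra.
by move=> z /andP[z0 z1]; rewrite fE // in_itv /=; apply/andP; split; lra.
Qed.

Lemma BV_left_limit f x : bounded_variation 0 1 f -> 0 < x <= 1 ->
  exists l : R, f z @[z --> x^'-] --> l.
Proof.
move=> /BV_decomposition[g [h [ndg ndh fE]]] x01.
have /cvg_ex[l hl] := nondecreasing_left_limit ndg x01.
have /cvg_ex[k hk] := nondecreasing_left_limit ndh x01.
exists (l - k); apply: cvg_trans (cvgB hl hk).
apply: near_eq_cvg; apply/at_leftE; move/andP: x01 => [x0 x1].
exists x; first by lra.
by move=> z /andP[z0 z1]; rewrite fE // in_itv /=; apply/andP; split; lra.
Qed.

(** * Jumps across a rational interval *)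

Context (f : R -> R) (a b : R).

(** All quantifiers range over codes of rationals, so that the condition is arithmetical in
    representations of y, a, b and f. *)
Definition jump (p q : nat) y : Prop :=
  rc p < rc q /\ a <= y /\ y <= b /\ forall s t, rc s < y -> y < rc t ->
    exists r, a <= rc r /\ rc r <= b /\ rc s < rc r /\ rc r < rc t /\
      (f y < rc p /\ rc q < f (rc r) \/ f (rc r) < rc p /\ rc q < f y).

Hypotheses (bv : bounded_variation 0 1 f) (a0 : 0 <= a) (b1 : b <= 1).

(** The order of the recursion. The usual order of the rationals is not well-founded; demanding a
    jump strictly between r and c makes it so. *)
Definition below (p q r c : nat) : Prop :=
  exists y, jump p q y /\ rc r < y < rc c.

(** Just to the right of m all values of f lie within (q - p)/2 of the right limit, so no two of
    them lie on opposite sides of [p,q]. *)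
Lemma jump_free_right p q m : 0 <= m < 1 ->
  exists2 e, 0 < e & forall y, m < y < m + e -> ~ jump p q y.
Proof.
move=> /(BV_right_limit bv)[l hl].
have [pq|qp] := ltP (rc p) (rc q); last first.
  by exists 1 => // y _ [pq _]; move: pq; rewrite ltNge qp.
have h0 : 0 < (rc q - rc p) / 2 by lra.
have [e e0 he] := (at_rightE _ _).1 (cvgr_dist_lt _ _ hl _ h0).
exists e => // y /andP[my ye] [_ [_ [_]]].
have [s /andP[s1 s2]] := rc_dense my.
have [t /andP[t1 t2]] := rc_dense ye.
move=> /(_ s t s2 t1)[r [_ [_ [r1 [r2 hr]]]]].
have := he y; rewrite my ye => /(_ isT); rewrite ltr_norml => /andP[? ?].
have := he (rc r); rewrite (lt_trans s1 r1) (lt_trans r2 t2) => /(_ isT).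
rewrite ltr_norml => /andP[? ?].
by case: hr => -[? ?]; lra.
Qed.

(** Let m be the infimum of the inaccessible rationals. Below an inaccessible c there is an
    inaccessible r with a jump between them. Taking c close to m puts this jump immediately to the
    right of m, against [jump_free_right]. *)
Lemma below_wf p q : well_founded (below p q).
Proof.
apply: contrapT => nwf.
have [c0 bad0] : exists c, ~ Acc (below p q) c.
  by apply/existsNP => h; exact: nwf.
pose B := [set rc c | c in [set c | ~ Acc (below p q) c]].
have step c : ~ Acc (below p q) c -> exists r y,
    [/\ ~ Acc (below p q) r, jump p q y, rc r < y & y < rc c].
  move=> bad; apply: contrapT => h; apply: bad; constructor.
  move=> r [y [jy /andP[ry yc]]].
  by apply: contrapT => bad; apply: h; exists r, y.
have Ba : lbound B a.
  move=> _ [c bad <-]; have [r [y [_ [_ [ay _]] _ yc]]] := step _ bad.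
  exact: ltW (le_lt_trans ay yc).
have Bi : has_inf B by split; [exists (rc c0), c0|exists a].
pose m := inf B.
have am : a <= m by apply: lb_le_inf => //; case: Bi.
have mB c : ~ Acc (below p q) c -> m <= rc c.
  by move=> bad; apply: ge_inf; [exists a|exists c].
have m1 : m < 1.
  have [r [y [bad [_ [_ [yb _]]] ry _]]] := step _ bad0.
  exact: le_lt_trans (mB _ bad) (lt_le_trans ry (le_trans yb b1)).
have [|e e0 he] := @jump_free_right p q m; first by rewrite (le_trans a0 am).
have [_ [c bad <-]] := inf_adherent e0 Bi; rewrite -/m => cm.
have [r [y [bad' jy ry yc]]] := step _ bad.
apply: (he y) => //; rewrite (le_lt_trans (mB _ bad') ry) /=.
exact: lt_trans yc cm.
Qed.

(** If l differed from f(y), rationals p and q between them would make y a jump. The last hypothesis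
    says that sets in the filter contain rationals of [a,b] arbitrarily near y, which covers limits
    from either side. *)
Lemma jump_limit (F : set_system R) {FF : ProperFilter F} l y :
  a <= y <= b -> (forall p q, ~ jump p q y) -> f z @[z --> F] --> l ->
  (forall s t P, s < y -> y < t -> F P ->
    exists r, P (rc r) /\ a <= rc r /\ rc r <= b /\ s < rc r /\ rc r < t) ->
  l = f y.
Proof.
move=> /andP[ay yb] nj hl dense; apply/eqP; rewrite eq_le !leNgt.
apply/andP; split; apply/negP => h.
  have [p /andP[yp pl]] := rc_dense h; have [q /andP[pq ql]] := rc_dense pl.
  apply: (nj p q); do 3!split => //; move=> s t sy yt.
  have [r [hr [? [? [? ?]]]]] := dense _ _ _ sy yt (cvgr_gt _ hl _ ql).
  by exists r; do 4!split => //; left.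
have [q /andP[lq qy]] := rc_dense h; have [p /andP[lp pq]] := rc_dense lq.
apply: (nj p q); do 3!split => //; move=> s t sy yt.
have [r [hr [? [? [? ?]]]]] := dense _ _ _ sy yt (cvgr_lt _ hl _ lp).
by exists r; do 4!split => //; right.
Qed.

Lemma rc_between_min x (u v w : R) : x < u -> x < v -> x < w ->
  exists r, x < rc r /\ rc r < u /\ rc r < v /\ rc r < w.
Proof.
move=> xu xv xw.
have : x < Num.min u (Num.min v w) by rewrite !lt_min xu xv xw.
by move=> /rc_dense[r]; rewrite !lt_min => /and4P[? ? ? ?]; exists r.
Qed.

Lemma rc_between_max x (u v w : R) : u < x -> v < x -> w < x ->
  exists r, rc r < x /\ u < rc r /\ v < rc r /\ w < rc r.
Proof.
move=> xu xv xw.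
have : Num.max u (Num.max v w) < x by rewrite !gt_max xu xv xw.
move=> /rc_dense[r]; rewrite !gt_max -!andbA => /and4P[? ? ? ?]; by exists r.
Qed.

Lemma jump_free_right_cvg y : (forall p q, ~ jump p q y) ->
  a <= y -> y < b -> f z @[z --> y^'+] --> f y.
Proof.
move=> nj ay yb.
have [|l hl] := @BV_right_limit f y bv.
  by rewrite (le_trans a0 ay) (lt_le_trans yb b1).
rewrite -[f y](jump_limit _ nj hl) // ?ay ?ltW // => s t P sy yt.
move=> /at_rightE[e e0 he].
have ye : y < y + e by lra.
have [r [r1 [r2 [r3 r4]]]] := rc_between_min yt yb ye.
exists r; split; first by apply: he; rewrite r1.
by split; [|split; [|split]] => //; lra.
Qed.

Lemma jump_free_left_cvg y : (forall p q, ~ jump p q y) ->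
  a < y -> y <= b -> f z @[z --> y^'-] --> f y.
Proof.
move=> nj ay yb.
have [|l hl] := @BV_left_limit f y bv.
  by rewrite (le_lt_trans a0 ay) (le_trans yb b1).
rewrite -[f y](jump_limit _ nj hl) // ?yb ?ltW // => s t P sy yt.
move=> /at_leftE[e e0 he].
have ye : y - e < y by lra.
have [r [r1 [r2 [r3 r4]]]] := rc_between_max sy ay ye.
exists r; split; first by apply: he; rewrite r1 andbT.
by split; [|split; [|split]] => //; lra.
Qed.

(** Continuity at y keeps nearby values within q - p of f(y), which excludes a jump. Conversely, in
    the absence of jumps the one-sided limits taken inside [a,b] equal f(y). *)
Lemma jump_freeP :
  {within `[a, b], continuous f} <-> forall p q y, ~ jump p q y.
Proof.
rewrite subspace_continuousP; split.
  move=> cont p q y [pq [ay [yb hy]]].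
  have e0 : 0 < rc q - rc p by lra.
  have /= := cont y; rewrite in_itv /= ay yb.
  move=> /(_ isT) /(cvgr_dist_lt _ _) /(_ _ e0).
  move=> [d /= d0 hd].
  have ydm : y - d < y by lra.
  have ydp : y < y + d by lra.
  have [s /andP[s1 s2]] := rc_dense ydm.
  have [t /andP[t1 t2]] := rc_dense ydp.
  have [r [r1 [r2 [r3 [r4 hr]]]]] := hy _ _ s2 t1.
  have := hd (rc r); rewrite /= in_itv /= r1 r2 => h.
  have : `|f y - f (rc r)| < rc q - rc p.
    by apply: h => //; rewrite ltr_norml; apply/andP; split; lra.
  rewrite ltr_norml => /andP[? ?].
  by case: hr => -[? ?]; lra.
move=> nj y /=; rewrite in_itv /= => /andP[ay yb].
have {}nj p q := nj p q y.
apply/cvgrPdist_lt => e e0.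
have [d1 d10 hd1] : exists2 d, 0 < d &
    forall z, y < z < y + d -> z <= b -> `|f y - f z| < e.
  (* At y = b there is no z to the right, and any radius serves. *)
  have [yb'|by'] := ltP y b; last by exists 1 => // z; lra.
  have /(cvgr_dist_lt _ _)/(_ _ e0)/at_rightE[d d0 hd] :=
    jump_free_right_cvg nj ay yb'.
  by exists d => // z /hd.
have [d2 d20 hd2] : exists2 d, 0 < d &
    forall z, y - d < z < y -> a <= z -> `|f y - f z| < e.
  have [ay'|ya'] := ltP a y; last by exists 1 => // z; lra.
  have /(cvgr_dist_lt _ _)/(_ _ e0)/at_leftE[d d0 hd] :=
    jump_free_left_cvg nj ay' yb.
  by exists d => // z /hd.
exists (Num.min d1 d2); first by rewrite /= lt_min d10.
move=> z /=; rewrite lt_min in_itv /= => dz zab.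
have [? [? [? ?]]] : y - d2 < z /\ z < y + d1 /\ a <= z /\ z <= b.
  move: dz zab; rewrite !ltr_norml => /andP[/andP[? ?] /andP[? ?]] /andP[? ?].
  by split; [|split; [|split]] => //; lra.
change (`|f y - f z| < e).
have [yz|zy|<-] := ltgtP y z.
- by apply: hd1 => //; rewrite yz /=; lra.
- by apply: hd2 => //; rewrite zy andbT; lra.
- by rewrite subrr normr0.
Qed.

End Jumps.

(** * Deciding continuity with Omega *)

Lemma dec_dvdn T (E : context T) f g : provides E (fun=> E2_fun) ->
  Cmp E f -> Cmp E g -> Dec E (fun t => f t %| g t).
Proof.
move=> h2 hf hg.
apply: (@dec_ext _ _ (fun t => exists c, g t = c * f t)) => [t|].
  by split=> /dvdnP.
apply: dec_ex => //.
exact: dec_eq (cmp_weak hg) (cmp_mul (cmp_var0 _) (cmp_weak hf)).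
Qed.

Lemma cmp_sum T (E : context T) (g : T -> nat -> nat) : CmpS E g ->
  CmpS E (fun t n => \sum_(1 <= k < n.+1) g t k).
Proof.
move=> hg; apply: (@cmp_rec _ _ (fun=> 0) (fun p => p.1.2 + g p.1.1 p.2.+1)).
- by move=> t; rewrite big_geq.
- by move=> t n /=; rewrite big_nat_recr.
- exact: cmp_const.
- apply: cmp_add (cmp_var1 _) _.
  have s := selects_pushN (selects_pushN (selects_refl E)).
  exact: (cmpS_at (cmpS_sub s hg) (cmp_succ (cmp_var0 _))).
Qed.

(** The exponent of p in n > 0 is the number of k with 1 <= k < n such that p^k divides n. *)
Lemma cmp_logn T (E : context T) p f : provides E (fun=> E2_fun) -> prime p ->
  Cmp E f -> Cmp E (fun t => logn p (f t)).
Proof.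
move=> h2 pp hf.
have h : CmpS E (fun t k => nat_of_bool (p ^ k %| f t)).
  have := dec_dvdn (provides_weak h2)
    (cmp_exp (cmp_const _ p) (cmp_var0 E)) (cmp_weak hf).
  by apply: cmp_ext => q; rewrite asboolb.
apply: cmp_ext (cmpS_at (cmp_sum h) (cmp_app1 cmp1_pred hf)) => t /=.
have [->|n0] := posnP (f t); first by rewrite logn0 big_geq.
by rewrite prednK // logn_count_dvd.
Qed.

Lemma dec_ltc T (E : context T) p q n : provides E (fun=> E2_fun) ->
  Cmp E p -> Cmp E q -> Cmp E n -> Dec E (fun t => ltc (p t) (q t) (n t)).
Proof.
move=> h2 hp hq hn.
apply: (dec_ext (fun t => iff_sym (ltcE (p t) (q t) (n t)))).
have hl r f (rp : prime r) := @cmp_logn _ E r f h2 rp.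
have hd f hf := cmp_succ (hl 5 f isT hf).
have h2n := cmp_exp (cmp_const E 2) hn.
apply: dec_leq.
  apply: cmp_succ; apply: cmp_mul h2n; apply: cmp_add; apply: cmp_mul;
  by [exact: hl | exact: hd].
apply: cmp_add (cmp_mul (hd _ hp) (hd _ hq)); apply: cmp_mul h2n.
by apply: cmp_add; apply: cmp_mul;
  [exact: hl | exact: hd..| exact: hl | exact: hd].
Qed.

Lemma dec_fast T (E : context T) u : provides E (fun=> E2_fun) ->
  CmpS E u -> Dec E (fun t => fast (u t)).
Proof.
move=> h2 hu; apply: dec_all => //.
apply: dec_all; first exact: (provides_weak h2).
have s := selects_pushN (selects_pushN (selects_refl E)).
have hu2 := cmpS_sub s hu; have hu2at := cmpS_at hu2.
have v0 := cmp_var0 (pushN E); have v1 := cmp_var1 E.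
have h22 := provides_weak (provides_weak h2).
by apply: dec_and; apply: dec_ltc => //; apply: hu2at => //; apply: cmp_add.
Qed.

Lemma dec_RLt T (E : context T) u v : provides E (fun=> E2_fun) ->
  CmpS E u -> CmpS E v -> Dec E (fun t => RLt (u t) (v t)).
Proof.
move=> h2 hu hv; have h22 := provides_weak h2; have h23 := provides_weak h22.
apply: dec_ex => //; apply: dec_ex => //; apply: dec_all => //; apply: dec_not.
have s := selects_pushN (selects_pushN (selects_pushN (selects_refl E))).
have hm := cmp_add (cmp_var1 (pushN E)) (cmp_var0 (pushN (pushN E))).
apply: dec_ltc (provides_weak h23) _ _ (cmp_var2 E).
  exact: cmpS_at (cmpS_sub s hv) hm.
exact: cmpS_at (cmpS_sub s hu) hm.
Qed.

Lemma cmpS_cst T (E : context T) c : Cmp E c -> CmpS E (fun t _ => c t).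
Proof. exact: cmp_weak. Qed.

Definition fun_type : ftype := (Nat ~> Nat) ~> Nat ~> Nat.

Lemma cmpS_fun T (E : context T) (F : T -> total_functional fun_type) u :
  provides E (fun t => tot (F t)) -> CmpS E u ->
  CmpS E (fun t => F t (u t)).
Proof.
move=> hF hu.
apply: (@cmp_app _ (pushN E) fun_type _
  (fun p => (u p.1, (p.2, tt))) _ (provides_weak hF)) => //.
have hu' := cmpS_sub (selects_pushN (selects_refl E)) hu.
split; first exact: (@cmp_args_seq _ (pushN E) _ hu').
by split=> //; exact: (@cmp_args_Nat _ (pushN E) _ (cmp_var0 E)).
Qed.

(** * The least jump, by recursion with Omega *)

Section FromOmega.
Local Open Scope ring_scope.
Context (R : realType).
Local Notation rc := (@rc R).

(** The inputs on which a decider is constrained, with the promises as fields. *)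
Record bv_input := BVInput {
  in_F : total_functional fun_type; in_f : R -> R;
  in_alpha : nat -> nat; in_a : R; in_beta : nat -> nat; in_b : R;
  in_rep_F : rep_fun in_F in_f; in_bv : bounded_variation 0 1 in_f;
  in_rep_a : rep_real in_alpha in_a; in_rep_b : rep_real in_beta in_b;
  in_a0 : 0 <= in_a; in_ab : in_a <= in_b; in_b1 : in_b <= 1 }.

(** [jump] on the level of representations, where rationals become constant sequences and f is
    accessible through [in_F] only. *)
Definition jump_seq (t : bv_input) (p q : nat) (u : nat -> nat) : Prop :=
  RLt (fun=> p) (fun=> q) /\ ~ RLt u (in_alpha t) /\ ~ RLt (in_beta t) u /\
  forall s w, RLt (fun=> s) u -> RLt u (fun=> w) ->
  exists r, ~ RLt (fun=> r) (in_alpha t) /\ ~ RLt (in_beta t) (fun=> r) /\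
    RLt (fun=> s) (fun=> r) /\ RLt (fun=> r) (fun=> w) /\
    (RLt (in_F t u) (fun=> p) /\ RLt (fun=> q) (in_F t (fun=> r)) \/
     RLt (in_F t (fun=> r)) (fun=> p) /\ RLt (fun=> q) (in_F t u)).

Lemma jump_seqP t p q u y : rep_real u y ->
  jump_seq t p q u <-> jump (in_f t) (in_a t) (in_b t) p q y.
Proof.
move=> uy; have a0 := in_a0 t; have b1 := in_b1 t.
have cst c d : RLt (fun=> c) (fun=> d) <-> rc c < rc d.
  by apply: RLt_rep; exact: rep_cst.
have ge_a v z : rep_real v z -> ~ RLt v (in_alpha t) <-> in_a t <= z.
  by move=> vz; rewrite (RLt_rep vz (in_rep_a t)) leNgt; exact: (rwP negP).
have le_b v z : rep_real v z -> ~ RLt (in_beta t) v <-> z <= in_b t.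
  by move=> vz; rewrite (RLt_rep (in_rep_b t) vz) leNgt; exact: (rwP negP).
have gt_c v z c : rep_real v z -> RLt (fun=> c) v <-> rc c < z.
  by apply: RLt_rep; exact: rep_cst.
have lt_c v z c : rep_real v z -> RLt v (fun=> c) <-> z < rc c.
  by move=> h; apply: (RLt_rep h); exact: rep_cst.
have Frep v z : in_a t <= z -> z <= in_b t -> rep_real v z ->
    rep_real (in_F t v) (in_f t z).
  move=> az zb; apply: in_rep_F.
  by rewrite in_itv /= (le_trans a0 az) (le_trans zb b1).
have main r : in_a t <= y -> y <= in_b t -> in_a t <= rc r -> rc r <= in_b t ->
    (RLt (in_F t u) (fun=> p) /\ RLt (fun=> q) (in_F t (fun=> r)) \/
     RLt (in_F t (fun=> r)) (fun=> p) /\ RLt (fun=> q) (in_F t u)) <->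
    (in_f t y < rc p /\ rc q < in_f t (rc r) \/
     in_f t (rc r) < rc p /\ rc q < in_f t y).
  move=> ay yb ar rb.
  have Fy := Frep _ _ ay yb uy; have Fr := Frep _ _ ar rb (rep_cst R r).
  by rewrite (lt_c _ _ p Fy) (lt_c _ _ p Fr) (gt_c _ _ q Fy) (gt_c _ _ q Fr).
split=> -[pq [ay [yb hy]]].
  move/(ge_a _ _ uy): ay => ay; move/(le_b _ _ uy): yb => yb.
  split; [exact/cst|split => //; split => // s w sy yw].
  have [||r [ar [rb [sr [rw h]]]]] := hy s w;
  [exact/(gt_c _ _ _ uy)|exact/(lt_c _ _ _ uy)|].
  move/(ge_a _ _ (rep_cst R r)): ar => ar.
  move/(le_b _ _ (rep_cst R r)): rb => rb.
  exists r; split => //; split => //; split; first exact/cst.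
  by split; [exact/cst|exact/main].
split; first exact/cst.
split; [exact/(ge_a _ _ uy)|split; [exact/(le_b _ _ uy)|move=> s w sy yw]].
have [||r [ar [rb [sr [rw h]]]]] := hy s w;
  [exact/(gt_c _ _ _ uy)|exact/(lt_c _ _ _ uy)|].
exists r; split; first exact/(ge_a _ _ (rep_cst R r)).
split; first exact/(le_b _ _ (rep_cst R r)).
by split; [exact/cst|split; [exact/cst|exact/main]].
Qed.

Variable Omega : partial_functional Omega_type.
Hypothesis OmegaP : is_Omega R Omega.

Definition bv_context : context bv_input :=
  @Context _ (fun t => [:: arg_of (s := fun_type) (in_F t);
    arg_of (s := Nat ~> Nat) (in_alpha t); arg_of (s := Nat ~> Nat) (in_beta t);
    Fun Omega; E2]) 5 (fun=> erefl).

Definition param : Type := (bv_input * nat * nat)%type.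
Definition param_context : context param := pushN (pushN bv_context).

Definition jump_at (t : param) (y : R) : Prop :=
  jump (in_f t.1.1) (in_a t.1.1) (in_b t.1.1) t.1.2 t.2 y.

Definition jump_below (t : param) (c : nat) : Prop :=
  exists y, jump_at t y /\ y < rc c.

Definition leftmost (t : param) (c : nat) (y : R) : Prop :=
  [/\ jump_at t y, y < rc c & forall r, rc r < y -> ~ jump_below t r].

Definition below_param (t : param) : nat -> nat -> Prop :=
  below (in_f t.1.1) (in_a t.1.1) (in_b t.1.1) t.1.2 t.2.

Lemma below_param_wf t : well_founded (below_param t).
Proof. apply: below_wf; [exact: in_bv|exact: in_a0|exact: in_b1]. Qed.

(** Well-founded induction on c: if the jump y is not leftmost, some r < y has a jump below it, and
    y itself witnesses that r precedes c. *)
Lemma jump_below_leftmost t c : jump_below t c <-> exists y, leftmost t c y.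
Proof.
split; last by move=> [y [jy yc _]]; exists y.
elim: c / (below_param_wf t c) => c _ IH [y [jy yc]].
have [[r [ry hr]]|h] := pselect (exists r, rc r < y /\ jump_below t r).
  have [|z [jz zr hz]] := IH r _ hr; first by exists y; rewrite ry yc.
  by exists z; split => //; rewrite (lt_trans zr) // (lt_trans ry).
by exists y; split => // r ry hr; apply: h; exists r.
Qed.

(** A rational between two such points would have the smaller one below it, so the larger one would
    not be leftmost. *)
Lemma leftmost_subset1 t c : is_subset1 (leftmost t c).
Proof.
move=> y z [jy yc hy] [jz zc hz].
have [yz|zy|//] := ltgtP y z.
  have [r /andP[yr rz]] := rc_dense yz.
  by have [] := hz _ rz; exists y.
have [r /andP[zr ry]] := rc_dense zy.
by have [] := hy _ ry; exists z.
Qed.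

Definition jump_num (t : param) (c : nat) : nat :=
  nat_of_bool `[< jump_below t c >].
Local Notation call := (call param_context below_param jump_num).
Local Notation call_context :=
  (call_context param_context below_param jump_num).

Definition in_leftmost (b : call) (u : nat -> nat) : Prop :=
  exists y, rep_real u y /\ leftmost (call_param b) (call_num b) y.

Definition leftmost_char (b : call) : total_functional ((Nat ~> Nat) ~> Nat) :=
  fun u => nat_of_bool `[< in_leftmost b u >].

(** The default 0 never replaces an undefined value, since Omega is applied to a set with at most
    one element. *)
Definition candidates (b : call) (n : nat) : nat :=
  odflt 0%N (Omega (leftmost_char b, (n, tt))).

Lemma leftmost_char_rep b :
  rep_set (leftmost_char b) (leftmost (call_param b) (call_num b)).
Proof.
split.
  move=> y [[_ [ay [yb _]]] _ _]; rewrite /= in_itv /=.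
  by rewrite (le_trans (in_a0 _) ay) (le_trans yb (in_b1 _)).
move=> u y _ uy; rewrite /leftmost_char; congr nat_of_bool.
apply: asbool_equiv_eq; split=> [[z [uz]]|]; last by exists y.
by rewrite (rep_unique uy uz).
Qed.

Lemma candidates_spec b :
  (forall n, Omega (leftmost_char b, (n, tt)) = Some (candidates b n)) /\
  exists2 s : seq R, rep_seq (candidates b) s &
    forall y, leftmost (call_param b) (call_num b) y -> y \in s.
Proof.
have [g hg [s gs hs]] := OmegaP (leftmost_char_rep b) (@leftmost_subset1 _ _).
have E : candidates b = g by apply/funext => n; rewrite /candidates hg.
by split; [move=> n; rewrite E | exists s => //; rewrite E].
Qed.

(** The list given by Omega contains the leftmost jump if there is one, but possibly other reals as
    well, so each entry is checked. Its i-th entry is read off the interleaving fixed in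
    [rep_seq]. *)
Lemma jump_below_candidates b :
  jump_below (call_param b) (call_num b) <->
  exists i, (i < candidates b 0)%N /\
    in_leftmost b (fun n => candidates b (n * candidates b 0 + i).+1).
Proof.
rewrite jump_below_leftmost; split; last by move=> [i [_ [y [_ h]]]]; exists y.
have [_ [s [h0 hs] mem_s]] := candidates_spec b.
move=> [y ly]; have := mem_s y ly => ys.
exists (index y s); rewrite h0 index_mem; split=> //.
exists y; split=> //; have := hs (index y s); rewrite index_mem => /(_ ys).
by rewrite nth_index.
Qed.

(** * Data and oracles available during a call *)

Section CallDecisions.
Context (T' : Type) (E' : context T') (b : T' -> call).
Hypothesis sub_b : selects E' call_context b.

Let sub_param : selects E' param_context (call_param \o b).
Proof. exact: selects_trans sub_b (selects_call _ _ _). Qed.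

Let sub_bv : selects E' bv_context (fst \o fst \o call_param \o b).
Proof.
apply: (selects_trans sub_param); rewrite /param_context.
exact: selects_pushN (selects_pushN (selects_refl _)).
Qed.

Lemma provides_E2 : provides E' (fun=> E2_fun).
Proof.
by apply: (@provides_sub _ _ _ _ _ _ (fun=> E2_fun) sub_bv); exists 4.
Qed.

Lemma provides_F : provides E' (fun t => tot (in_F (call_param (b t)).1.1)).
Proof.
apply: (@provides_sub _ _ _ _ _ _ (fun t => tot (in_F t)) sub_bv).
by exists 0%N.
Qed.

Lemma provides_Omega : provides E' (fun=> Omega).
Proof.
by apply: (@provides_sub _ _ _ _ _ _ (fun=> Omega) sub_bv); exists 3.
Qed.

Lemma cmpS_alpha : CmpS E' (fun t => in_alpha (call_param (b t)).1.1).
Proof.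
apply: (cmpS_sub sub_bv (u := in_alpha)).
apply: (@cmp_app_seq _ _ (fun p => in_alpha p.1)); last exact: cmp_var0.
by exists 2.
Qed.

Lemma cmpS_beta : CmpS E' (fun t => in_beta (call_param (b t)).1.1).
Proof.
apply: (cmpS_sub sub_bv (u := in_beta)).
apply: (@cmp_app_seq _ _ (fun p => in_beta p.1)); last exact: cmp_var0.
by exists 3.
Qed.

Lemma cmp_p : Cmp E' (fun t => (call_param (b t)).1.2).
Proof. exact: (cmp_sub sub_param (cmp_var1 _)). Qed.

Lemma cmp_q : Cmp E' (fun t => (call_param (b t)).2).
Proof. exact: (cmp_sub sub_param (cmp_var0 _)). Qed.

Lemma cmp_c : Cmp E' (fun t => call_num (b t)).
Proof. exact: (cmp_sub sub_b (cmp_call_num _ _ _)). Qed.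

End CallDecisions.

Lemma dec_jump_seq T' (E' : context T') (b : T' -> call) u :
  selects E' call_context b -> CmpS E' u ->
  Dec E' (fun t => jump_seq (call_param (b t)).1.1 (call_param (b t)).1.2
                     (call_param (b t)).2 (u t)).
Proof.
move=> sb hu.
have L T'' (E'' : context T'') b'' (s : selects E'' call_context b'') v w :=
  @dec_RLt T'' E'' v w (provides_E2 s).
have p0 := cmpS_cst (cmp_p sb); have q0 := cmpS_cst (cmp_q sb).
apply: dec_and; first exact: (L _ _ _ sb _ _ p0 q0).
apply: dec_and; first exact: dec_not (L _ _ _ sb _ _ hu (cmpS_alpha sb)).
apply: dec_and; first exact: dec_not (L _ _ _ sb _ _ (cmpS_beta sb) hu).
apply: dec_all; first exact: (provides_E2 sb).
apply: dec_all; first exact: (provides_E2 (selects_pushN sb)).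
have ss := selects_pushN (selects_pushN sb).
have s2 := selects_pushN (selects_pushN (selects_refl E')).
have hu2 := cmpS_sub s2 hu.
apply: dec_imp; first exact: (L _ _ _ ss _ _ (cmpS_cst (cmp_var1 _)) hu2).
apply: dec_imp; first exact: (L _ _ _ ss _ _ hu2 (cmpS_cst (cmp_var0 _))).
apply: dec_ex; first exact: (provides_E2 ss).
have sb3 := selects_pushN ss; have s3 := selects_pushN s2.
have hu3 := cmpS_sub s3 hu.
have p3 := cmpS_cst (cmp_p sb3); have q3 := cmpS_cst (cmp_q sb3).
have r3 := cmpS_cst (cmp_var0 (pushN (pushN E'))).
have Fu := cmpS_fun (provides_F sb3) hu3.
have Fr := cmpS_fun (provides_F sb3) r3.
have {}L := L _ _ _ sb3.
apply: dec_and; first exact: dec_not (L _ _ r3 (cmpS_alpha sb3)).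
apply: dec_and; first exact: dec_not (L _ _ (cmpS_beta sb3) r3).
apply: dec_and; first exact: (L _ _ (cmpS_cst (cmp_var2 _)) r3).
apply: dec_and; first exact: (L _ _ r3 (cmpS_cst (cmp_var1 _))).
apply: dec_or; apply: dec_and.
- exact: (L _ _ Fu p3).
- exact: (L _ _ q3 Fr).
- exact: (L _ _ Fr p3).
- exact: (L _ _ q3 Fu).
Qed.

(** The part of [in_leftmost] that is decided without recursive calls. *)
Definition jump_candidate (b : call) (u : nat -> nat) : Prop :=
  fast u /\ jump_seq (call_param b).1.1 (call_param b).1.2 (call_param b).2 u /\
  RLt u (fun=> call_num b).

Lemma jump_candidateP b u : jump_candidate b u <->
  exists y, rep_real u y /\ jump_at (call_param b) y /\ y < rc (call_num b).
Proof.
split=> [[/(fast_rep R)[y uy]]|[y [uy]]].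
  rewrite (jump_seqP _ _ _ uy) (RLt_rep uy (rep_cst R _)) => h.
  by exists y.
rewrite /jump_candidate (jump_seqP _ _ _ uy) (RLt_rep uy (rep_cst R _)) => h.
by split=> //; apply/fastE; case: uy.
Qed.

Lemma in_leftmostE b u : in_leftmost b u <->
  jump_candidate b u /\
  ~ exists r, RLt (fun=> r) u /\ jump_below (call_param b) r.
Proof.
rewrite jump_candidateP; split.
  move=> [y [uy [jy yc hy]]]; split; first by exists y.
  by move=> [r]; rewrite (RLt_rep (rep_cst R r) uy) => -[/hy].
move=> [[y [uy [jy yc]]] h]; exists y; split => //; split => // r ry hr.
by apply: h; exists r; rewrite (RLt_rep (rep_cst R r) uy).
Qed.

(** S8 requires the characteristic function to be total, so a recursive call at r must be made only
    where it is known to succeed. The two guards ensure that u represents a jump y < c and that r <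
    y; then y shows that r precedes c. *)
Lemma dec_in_leftmost T' (E' : context T') (b : T' -> call) u :
  selects E' call_context b -> CmpS E' u ->
  Dec E' (fun t => in_leftmost (b t) (u t)).
Proof.
move=> sb hu.
apply: (dec_ext (fun t => iff_sym (in_leftmostE (b t) (u t)))).
apply: dec_guard.
  apply: dec_and; first exact: dec_fast (provides_E2 sb) hu.
  apply: dec_and; first exact: dec_jump_seq.
  exact: dec_RLt (provides_E2 sb) hu (cmpS_cst (cmp_c sb)).
pose P t := jump_candidate (b t) (u t).
have sb1 := selects_restrict P sb.
have hu1 := cmpS_sub (selects_restrict P (selects_refl E')) hu.
apply: dec_not; apply: (@dec_ex _ _ (fun s r => RLt (fun=> r) (u (sval s)) /\
  jump_below (call_param (b (sval s))) r)).
  exact: (provides_E2 sb1).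
have sb2 := selects_pushN sb1.
have hu2 := cmpS_sub (selects_pushN (selects_refl _)) hu1.
apply: dec_guard.
  exact: dec_RLt (provides_E2 sb2) (cmpS_cst (cmp_var0 _)) hu2.
pose Q (p : {t | P t} * nat) := RLt (fun=> p.2) (u (sval p.1)).
have sb3 := selects_restrict Q sb2.
apply: (cmp_call sb3 (g := fun s => (sval s).2)).
  exact: (cmp_sub (selects_restrict Q (selects_refl _)) (cmp_var0 _)).
move=> [[[t Pt] r] Qr] /=; have [y [uy [jy yc]]] := (jump_candidateP _ _).1 Pt.
by exists y; split=> //; rewrite yc andbT; apply/(RLt_rep (rep_cst R r) uy).
Qed.

Lemma cmpS_candidates : CmpS call_context candidates.
Proof.
have s := selects_pushN (selects_refl call_context).
apply: (@cmp_app _ (pushN call_context) Omega_type (fun=> Omega)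
  (fun p => (leftmost_char p.1, (p.2, tt)))); first exact: (provides_Omega s).
  by move=> p; rewrite (candidates_spec p.1).1.
split; last first.
  by split=> //; exact: (@cmp_args_Nat _ (pushN call_context) _ (cmp_var0 _)).
have := @dec_in_leftmost _ (pushF (Nat ~> Nat) (pushN call_context))
  _ snd (selects_pushF _ s).
have h : CmpS (pushF (Nat ~> Nat) (pushN call_context)) snd.
  apply: (@cmp_app_seq _ _ (fun p => p.1.2)); last exact: cmp_var0.
  by exists 1%N.
by move=> /(_ h); apply: (cmp_eqv (tau := fun p => (p.1, p.2.1))).
Qed.

(** The equivalence [jump_below_candidates] serves as the recursion equation for [cmp_fix]. *)
Lemma dec_jump_below : Dec (pushN param_context) (fun p => jump_below p.1 p.2).
Proof.
apply: (@cmp_fix _ param_context below_param jump_num below_param_wf).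
rewrite -/call_context.
apply: (dec_ext (fun b => iff_sym (jump_below_candidates b))).
have h := cmpS_candidates.
have s := selects_pushN (selects_refl call_context).
have h0 : Cmp (pushN call_context) (fun p => candidates p.1 0).
  exact: (cmp_weak (cmpS_at h (cmp_const _ 0))).
apply: dec_ex; first exact: (provides_E2 (selects_refl _)).
apply: dec_and; first exact: dec_leq (cmp_succ (cmp_var0 _)) h0.
apply: dec_in_leftmost => //.
have s2 := selects_pushN s.
apply: (cmpS_at (cmpS_sub s2 h)); apply: cmp_succ.
exact: cmp_add (cmp_mul (cmp_var0 _) (cmp_weak h0)) (cmp_var1 _).
Qed.

Lemma dec_bv_continuous :
  Dec bv_context (fun t => {within `[in_a t, in_b t], continuous (in_f t)}).
Proof.
have h2 : provides bv_context (fun=> E2_fun) by exists 4.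
have h : Dec bv_context (fun t => ~ exists p q c, jump_below (t, p, q) c).
  apply: dec_not; apply: dec_ex => //.
  apply: dec_ex; first exact: (provides_weak h2).
  apply: dec_ex; first exact: provides_weak (provides_weak h2).
  apply: dec_ext dec_jump_below => -[[[t p] q] c] //.
apply: dec_ext h => t.
rewrite (jump_freeP (in_bv t) (in_a0 t) (in_b1 t)); split.
  move=> h p q y jy; apply: h; exists p, q.
  have y1 : y < y + 1 by rewrite ltrDl.
  have [c /andP[yc _]] := rc_dense y1.
  by exists c, y.
by move=> h [p [q [c [y [/h]]]]].
Qed.

End FromOmega.

(** * A decider computable in Omega *)

Section BVDecider.
Local Open Scope ring_scope.
Context (R : realType).

Definition bv_targs (t : bv_input R) : targs BV_cont_type :=
  (in_F t, (in_alpha t, (in_beta t, tt))).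

(** Defined only on inputs that meet the promises, where the program terminates. *)
Definition bv_decider : partial_functional BV_cont_type := fun xi =>
  match pselect (exists t, bv_targs t = xi) with
  | left h => let t := projT1 (cid h) in
      Some (nat_of_bool `[< {within `[in_a t, in_b t], continuous (in_f t)} >])
  | right _ => None
  end.

(** Inputs with equal representations share a, b and the values of f on [a,b], so the choice made by
    [cid] does not affect the answer. *)
Lemma bv_decider_decides : decides_BV_continuity R bv_decider.
Proof.
move=> F f alpha a beta b hF hf ha hb a0 ab b1.
rewrite /bv_decider; case: pselect => [h|[]]; last first.
  by exists (BVInput hF hf ha hb a0 ab b1).
case: (cid h) => -[F' f' alpha' a' beta' b' hF' hf' ha' hb' a0' ab' b1'] /= [].
move=> eF ealpha ebeta; move: hF' ha' hb'; rewrite eF ealpha ebeta.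
move=> hF' ha' hb'; congr (Some (nat_of_bool _)); apply: asbool_equiv_eq.
rewrite (rep_unique ha' ha) (rep_unique hb' hb).
have ff' x : x \in `[a, b] -> f' x = f x.
  rewrite in_itv /= => /andP[ax xb].
  have x01 : x \in `[0, 1].
    by rewrite in_itv /= (le_trans a0 ax) (le_trans xb b1).
  have [u ux] := rep_exists x.
  exact: rep_unique (hF' u x x01 ux) (hF u x x01 ux).
split; apply: subspace_eq_continuous => x; rewrite inE => xab.
  exact: ff'.
exact/esym/ff'.
Qed.

Lemma bv_decider_computable : computable_in_Omega R bv_decider.
Proof.
move=> Omega hO; have [e he] := dec_bv_continuous hO; exists e => xi v.
rewrite /bv_decider; case: pselect => // h.
by case: (cid h) => t /= <- [<-]; exact: he.
Qed.

End BVDecider.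

(** * Computing Omega from continuity *)

(** Bounded search in primitive recursive form for the largest number with P. The default 0 will
    make Omega list the real 0 for the empty set. *)
Definition last_true (P : nat -> Prop) :=
  fix aux j := if j is n.+1 then if `[< P n >] then n else aux n else 0.

Lemma last_trueP (P : nat -> Prop) N : (exists2 j, j < N & P j) ->
  last_true P N < N /\ P (last_true P N).
Proof.
elim: N => [[]//|N IH [j jN Pj]] /=; case: asboolP => // nP.
have [|h1 h2] := IH; last by split=> //; exact: ltnW.
exists j => //; rewrite ltn_neqAle -ltnS jN andbT.
by apply/eqP => jN'; case: nP; rewrite -jN'.
Qed.

Lemma last_true_none (P : nat -> Prop) N :
  (forall j, ~ P j) -> last_true P N = 0.
Proof. by move=> h; elim: N => //= N ->; rewrite asboolF. Qed.

(* The denominator max(2^m, j + 1), minus 1 as in [frac]: the oracle may only be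
   asked about subintervals of [0,1], whatever the value of j. *)
Definition grid (m j : nat) : nat := (2 ^ m - 1) + (j.+1 - 2 ^ m).

Lemma gridE m j : j < 2 ^ m -> (grid m j).+1 = 2 ^ m.
Proof.
by rewrite /grid => h; have : 0 < 2 ^ m by [rewrite expn_gt0]; lia.
Qed.

Lemma leq_grid m j : j <= grid m j.
Proof. by rewrite /grid; have : 0 < 2 ^ m by [rewrite expn_gt0]; lia. Qed.

(** The codes 1 and 2 denote the rationals 0 and 1, so the successor turns a bit into a constant
    sequence representing it. *)
Definition shift_fun (F : total_functional ((Nat ~> Nat) ~> Nat)) :
  total_functional fun_type := fun u _ => (F u).+1.

Section OmegaFromDecider.
Local Open Scope ring_scope.
Context (R : realType).
Variable Phi : partial_functional BV_cont_type.
Hypothesis PhiP : @decides_BV_continuity R Phi.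
Local Notation rc := (@rc R).


(** * Locating the element by continuity queries *)

Definition indicator (X : set R) (x : R) : R := (nat_of_bool `[< X x >])%:R.

Lemma rep_indicator F X : rep_set F X -> rep_fun (shift_fun F) (indicator X).
Proof.
move=> [_ FX] u x x01 ux; rewrite /shift_fun (FX u x x01 ux) /indicator.
set c := nat_of_bool _; suff <- : rc c.+1 = c%:R by exact: rep_cst.
have -> : c.+1 = frac c 0 by rewrite /frac /c; case: asboolP.
by rewrite rc_frac divr1.
Qed.

Lemma indicator_bv X : is_subset1 X -> bounded_variation 0 1 (indicator X).
Proof.
move=> X1; have [[x Xx]|X0] := pselect (exists x, X x); last first.
  apply: nondecreasing_bounded_variation => u v _ _ _.
  by rewrite /indicator !asboolF // => Xu; apply: X0; [exists v|exists u].
(* The indicator of {x} is the difference of two monotone step functions, those of [x,oo) and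
   (x,oo). *)
have -> : indicator X = (fun z => (nat_of_bool (x <= z))%:R) \+
    (\- (fun z => (nat_of_bool (x < z))%:R)).
  apply/funext => z /=; rewrite /indicator.
  have [xz|zx|<-] := ltgtP x z; last by rewrite asboolT // subr0.
    by rewrite asboolF ?subrr // => Xz; move: xz; rewrite (X1 _ _ Xx Xz) ltxx.
  by rewrite asboolF ?subrr // => Xz; move: zx; rewrite (X1 _ _ Xx Xz) ltxx.
apply: bounded_variationD => //; last apply: bounded_variationN;
  apply: nondecreasing_bounded_variation => u v _ _ uv; rewrite ler_nat.
  by case: leP => // xu; rewrite (le_trans xu uv).
by case: ltP => // xu; rewrite (lt_le_trans xu uv).
Qed.

Lemma indicator_continuous X (l r : R) :
  is_subset1 X -> 0 <= l -> l < r -> r <= 1 ->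
  {within `[l, r], continuous (indicator X)} <-> ~ exists2 x, X x & l <= x <= r.
Proof.
move=> X1 l0 lr r1; rewrite (jump_freeP (indicator_bv X1) l0 r1).
split=> [nj [x Xx /andP[lx xr]]|h p q y].
  (* Any rationals 0 < p < q < 1 separate the value 1 at x from the value 0 elsewhere. *)
  have [q /andP[q0 q1]] := @rc_dense R 0 1 ltr01.
  have [p /andP[p0 pq]] := @rc_dense R 0 _ q0.
  apply: (nj p q x); split=> //; split=> //; split=> // s w sx xw.
  suff [c [cx [lc [cr [sc cw]]]]] : exists c, rc c <> x /\
      l <= rc c /\ rc c <= r /\ rc s < rc c /\ rc c < rc w.
    have f0 : indicator X (rc c) = 0.
      by rewrite /indicator asboolF // => Xc; apply: cx; exact: X1.
    have f1 : indicator X x = 1 by rewrite /indicator asboolT.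
    by exists c; do 4!split => //; right; rewrite f0 f1.
  (* As l < r, the interval contains rationals arbitrarily near x on at least one side: the right
     one, or the left one if x = r. *)
  have [xr'|rx] := ltP x r.
    have [c [? [? [? ?]]]] := rc_between_min xw xr' xr'.
    exists c; split; first by move=> ?; lra.
    by split; [|split; [|split]] => //; lra.
  have lx' : l < x by lra.
  have [c [? [? [? ?]]]] := rc_between_max sx lx' lx'.
  exists c; split; first by move=> ?; lra.
  by split; [|split; [|split]] => //; lra.
move=> [pq [ly [yr /(_ _ _)hy]]].
have y1 : y - 1 < y by lra.
have y2 : y < y + 1 by lra.
have [s /andP[_ sy]] := rc_dense y1; have [w /andP[yw _]] := rc_dense y2.
have [c [lc [cr [_ [_]]]]] := hy s w sy yw.
have f0 z : l <= z -> z <= r -> indicator X z = 0.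
  move=> lz zr; rewrite /indicator asboolF // => Xz; apply: h.
  by exists z => //; rewrite lz.
by rewrite !f0 //; case=> -[? ?]; lra.
Qed.

(** The answer 0, discontinuity, signals that the queried interval meets X. *)
Definition hit (F : total_functional ((Nat ~> Nat) ~> Nat)) (m j : nat) : nat :=
  odflt 0%N (Phi (shift_fun F, (fun=> frac j (grid m j),
    (fun=> frac j.+1 (grid m j), tt)))).

Lemma hit_spec F X m j : rep_set F X -> is_subset1 X ->
  Phi (shift_fun F, (fun=> frac j (grid m j),
    (fun=> frac j.+1 (grid m j), tt))) =
    Some (hit F m j) /\
  (hit F m j = 0%N <->
     exists2 x, X x & rc (frac j (grid m j)) <= x <= rc (frac j.+1 (grid m j))).
Proof.
move=> FX X1; have d0 : 0 < ((grid m j).+1%:R : R) by rewrite ltr0n.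
have l0 : 0 <= rc (frac j (grid m j)) by rewrite rc_frac divr_ge0.
have lr : rc (frac j (grid m j)) < rc (frac j.+1 (grid m j)).
  by rewrite !rc_frac ltr_pM2r ?invr_gt0 // ltr_nat.
have r1 : rc (frac j.+1 (grid m j)) <= 1.
  by rewrite rc_frac ler_pdivrMr // mul1r ler_nat ltnS leq_grid.
have h := PhiP (rep_indicator FX) (indicator_bv X1)
  (rep_cst R (frac j (grid m j))) (rep_cst R (frac j.+1 (grid m j)))
  l0 (ltW lr) r1.
split; first by rewrite /hit h.
rewrite /hit h /=; have hc := indicator_continuous X1 l0 lr r1.
case: asboolP => [/hc h'|nc]; first by split.
by split=> // _; apply: contrapT => /hc.
Qed.

(** Entry 0 is the length 1 of the list. Entry n+1 is the left endpoint of a dyadic interval of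
    level n+2, the precision required by [rep_approx]. *)
Definition omega_seq (F : total_functional ((Nat ~> Nat) ~> Nat)) (n : nat) :
    nat :=
  if n is n'.+1 then
    frac (last_true (fun j => hit F n.+1 j = 0%N) (2 ^ n.+1)) (2 ^ n.+1 - 1)
  else 1%N.

(** By bisection; the intervals are closed, so that x = 1 belongs to the last one. *)
Lemma dyadic_interval (x : R) m : 0 <= x <= 1 ->
  exists2 j, (j < 2 ^ m)%N & j%:R <= x * 2 ^+ m <= j.+1%:R.
Proof.
move=> /andP[x0 x1]; elim: m => [|m [j jm /andP[h1 h2]]].
  by exists 0%N => //; rewrite expr0 mulr1 x0.
have [h|h] := leP (x * 2 ^+ m.+1) (2 * j).+1%:R.
  exists (2 * j)%N; first by rewrite expnS ltn_pmul2l.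
  by rewrite h andbT exprS natrM mulrCA ler_pM2l // ltr0n.
exists (2 * j).+1; first by rewrite expnS; lia.
rewrite (ltW h) /= (_ : (2 * j).+2 = 2 * j.+1)%N; last lia.
by rewrite exprS natrM mulrCA ler_pM2l // ltr0n.
Qed.

(** The last two hypotheses make x the element of X, or 0 if X is empty. In the first case x lies in
    the interval found, whose length is 2^-(n+2); in the second the search falls back on 0. *)
Lemma omega_seq_approx F X x n : rep_set F X -> is_subset1 X -> 0 <= x <= 1 ->
  ((exists y, X y) -> X x) -> (~ (exists y, X y) -> x = 0) ->
  `|rc (omega_seq F n.+1) - x| <= 2 ^- n.+2.
Proof.
move=> FX X1 x01 Xx X0; set m := n.+2.
have m0 : 0 < (2 ^+ m : R) by rewrite exprn_gt0.
have den : ((2 ^ m - 1).+1%:R : R) = 2 ^+ m.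
  by rewrite subn1 prednK ?expn_gt0 // natrX.
rewrite /omega_seq -/m; set P := fun j => _; set N := (2 ^ m)%N.
have [Xne|Xe] := pselect (exists y, X y); last first.
  rewrite last_true_none; last first.
    move=> j; rewrite /P (hit_spec m j FX X1).2 => -[y Xy _].
    by apply: Xe; exists y.
  by rewrite rc_frac mul0r X0 // subrr normr0 invr_ge0 ltW.
have sE (j : nat) (z : R) : (j%:R / 2 ^+ m <= z <= j.+1%:R / 2 ^+ m ) =
    (j%:R <= z * 2 ^+ m <= j.+1%:R) by rewrite ler_pdivrMr // ler_pdivlMr.
have PE j : (j < N)%N -> P j <-> j%:R <= x * 2 ^+ m <= j.+1%:R.
  move=> jN; rewrite /P (hit_spec m j FX X1).2 !rc_frac gridE // natrX -sE.
  split.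
    by move=> [y Xy]; rewrite (X1 _ _ (Xx Xne) Xy).
  by move=> h; exists x => //; exact: Xx.
have [|jN Pj] := @last_trueP P N.
  by have [j jN hj] := dyadic_interval m x01; exists j => //; apply/PE.
move: Pj; rewrite PE // rc_frac den; set j := last_true _ _.
rewrite -sE => /andP[h1 h2].
rewrite -natr1 mulrDl mul1r in h2.
have : 0 < (2 ^- m : R) by rewrite invr_gt0.
by rewrite ler_norml => ?; apply/andP; split; lra.
Qed.

(** Undefined unless the argument represents a set with at most one element, since [Phi] may be
    undefined on the resulting queries. *)
Definition omega : partial_functional Omega_type := fun xi =>
  if `[< exists X : set R, rep_set xi.1 X /\ is_subset1 X >]
  then Some (omega_seq xi.1 xi.2.1) else None.

Lemma omegaP : is_Omega R omega.
Proof.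
move=> F X FX X1; exists (omega_seq F).
  by move=> n; rewrite /omega /= asboolT //; exists X.
have [x [x01 Xx X0]] : exists x, [/\ 0 <= x <= 1, (exists y, X y) -> X x
    & ~ (exists y, X y) -> x = 0].
  have [[x Xx]|Xe] := pselect (exists x, X x); last first.
    by exists 0; rewrite lexx ler01.
  exists x; split=> //; last by case; exists x.
  by have := FX.1 x Xx; rewrite /= in_itv.
exists [:: x]; last first.
  by move=> y Xy; rewrite inE; apply/eqP; apply: X1 => //; apply: Xx; exists y.
split=> // -[|//] _ /=; apply: rep_approx => n; rewrite muln1 addn0.
exact: (omega_seq_approx n FX X1 x01 Xx X0).
Qed.

(** * Computing the list from the decider *)

Record omega_input := OmegaInput {
  om_F : total_functional ((Nat ~> Nat) ~> Nat); om_X : set R;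
  om_rep : rep_set om_F om_X; om_subset1 : is_subset1 om_X }.

Definition omega_context : context omega_input :=
  @Context _ (fun t => [:: arg_of (s := (Nat ~> Nat) ~> Nat) (om_F t); Fun Phi])
    2 (fun=> erefl).

Lemma cmp_frac T (E : context T) j d : Cmp E j -> Cmp E d ->
  Cmp E (fun t => frac (j t) (d t)).
Proof.
move=> hj hd; apply: cmp_mul; first exact: cmp_exp (cmp_const _ _) hj.
by apply: cmp_mul (cmp_const _ _) _; apply: cmp_exp (cmp_const _ _) hd.
Qed.

Lemma cmp_hit : Cmp (pushN (pushN omega_context))
  (fun p => hit (om_F p.1.1) p.1.2 p.2).
Proof.
set E := pushN (pushN omega_context).
have hm : Cmp E (fun p => 2 ^ p.1.2)%N.
  exact: cmp_exp (cmp_const _ _) (cmp_var1 _).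
have hj : Cmp E (fun p => p.2) by exact: cmp_var0.
have hg : Cmp E (fun p => grid p.1.2 p.2).
  apply: cmp_add; first exact: cmp_subn hm (cmp_const _ _).
  exact: cmp_subn (cmp_succ hj) hm.
apply: (@cmp_app _ E BV_cont_type (fun=> Phi) (fun p => (shift_fun (om_F p.1.1),
  (fun=> frac p.2 (grid p.1.2 p.2),
    (fun=> frac p.2.+1 (grid p.1.2 p.2), tt))))).
- by exists 3.
- by move=> p; rewrite (hit_spec _ _ (om_rep p.1.1) (@om_subset1 p.1.1)).1.
split; last split; last split => //.
- set E' := pushF (Nat ~> Nat) (pushN E).
  have : Cmp E' (fun p => (om_F p.1.1.1.1 p.2).+1).
    apply: cmp_succ; apply: (@cmp_app _ _ ((Nat ~> Nat) ~> Nat)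
      (fun p => tot (om_F p.1.1.1.1)) (fun p => (p.2, tt))) => //.
      by exists 4.
    split=> //; apply: (@cmp_args_seq _ E' snd).
    apply: (@cmp_app_seq _ _ (fun p => p.1.2)); last exact: cmp_var0.
    by exists 1%N.
  by apply: (cmp_eqv (tau := fun p => (p.1, p.2.2.1, p.2.1))).
- exact: (@cmp_args_seq _ E _ (cmpS_cst (cmp_frac hj hg))).
- exact: (@cmp_args_seq _ E _ (cmpS_cst (cmp_frac (cmp_succ hj) hg))).
Qed.

Lemma cmp_hit_at T (E : context T) tau m j : selects E omega_context tau ->
  Cmp E m -> Cmp E j -> Cmp E (fun t => hit (om_F (tau t)) (m t) (j t)).
Proof.
move=> s hm hj.
apply: (cmp_let (h := fun p => hit (om_F (tau p.1)) p.2 (j p.1)) hm).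
apply: (cmp_let (h := fun p => hit (om_F (tau p.1.1)) p.1.2 p.2) (cmp_weak hj)).
exact: (cmp_sub (selects_lift (selects_lift s)) cmp_hit).
Qed.

Lemma cmp_omega_seq : CmpS omega_context (fun t => omega_seq (om_F t)).
Proof.
have s := selects_pushN (selects_refl omega_context).
have hl : CmpS (pushN omega_context)
    (fun p => last_true (fun j => hit (om_F p.1) p.2.+2 j = 0%N)).
  apply: (@cmp_rec _ _ (fun=> 0%N) (fun p =>
    if `[< hit (om_F p.1.1.1) p.1.1.2.+2 p.2 = 0%N >]
    then p.2 else p.1.2)) => //.
    exact: cmp_const.
  apply: cmp_if (cmp_var0 _) (cmp_var1 _); apply: dec_eq0.
  apply: (cmp_hit_at (selects_pushN (selects_pushN s))); last exact: cmp_var0.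
  exact: cmp_succ (cmp_succ (cmp_var2 _)).
have h2 : Cmp (pushN (pushN omega_context)) (fun p => 2 ^ p.2.+2)%N.
  exact: cmp_exp (cmp_const _ _) (cmp_succ (cmp_succ (cmp_var0 _))).
apply: (@cmp_rec _ _ (fun=> 1%N) (fun p =>
  frac (last_true (fun j => hit (om_F p.1.1) p.2.+2 j = 0%N) (2 ^ p.2.+2))
       (2 ^ p.2.+2 - 1))) => //.
  exact: cmp_const.
apply: cmp_frac (cmp_subn h2 (cmp_const _ _)).
exact: cmpS_at (cmpS_sub (selects_lift s) hl) h2.
Qed.

Lemma omega_computable : computable_in omega [:: Fun Phi; E2].
Proof.
pose F0 p := arg_of (s := (Nat ~> Nat) ~> Nat) (@om_F p).
have hs : selects (@Context (omega_input * nat)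
    (fun p => [:: F0 p.1; Num p.2; Fun Phi; E2]) 4 (fun=> erefl))
    (pushN omega_context) id.
  (* The number argument is moved in front of [F], where [pushN] expects it. *)
  by exists [:: 1; 0; 2]%N.
have [e he] := cmp_sub hs cmp_omega_seq; exists e => -[F [n []]] v.
rewrite /omega /=; case: asboolP => // -[X [FX X1]] [<-].
exact: (he (OmegaInput FX X1, n)).
Qed.

End OmegaFromDecider.

Theorem theorem4p23 (R : realType) :
  class_in_Omega_cluster R (@decides_BV_continuity R).
Proof.
have computes Phi : @decides_BV_continuity R Phi -> computes_Omega R Phi.
  by move=> h; exists (omega R Phi); [exact: omegaP|exact: omega_computable].
split=> //; exists (@bv_decider R); first exact: bv_decider_decides.
split; first exact: bv_decider_computable.
exact/computes/bv_decider_decides.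
Qed.
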